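(* Let $(A(\cdot),b(\cdot),b'(\cdot),c)$ be an explicit $s$-stage FCRKN method satisfying $$\sum_{i=1}^s b'_i(\alpha)=\alpha,\qquad \sum_{i=1}^s b_i(\alpha)=\frac{\alpha^2}{2}\qquad(\alpha\in[0,1]),$$ $$\sum_{j=1}^s a_{ij}(\alpha)=\frac{\alpha^2}{2}\qquad(\alpha\in[0,c_i],\ i=1,\dots,s).$$ Assume that $f$ is of class $C^1$ with respect to the second argument and that the solution $u$ is of piecewise class $C^3$. Then the method is of uniform order two if and only if $$\sum_{i=1}^s b'_i(\alpha)\,c_i=\frac{\alpha^2}{2},\qquad \alpha\in[0,1],$$ and it is of discrete order two if and only if $$\sum_{i=1}^s b'_i(1)\,c_i=\frac12 .$$
   Context: Spaces. For $r\in[0,\infty]$, $\mathcal C$ is the space of continuous functions $[-r,0]\to\mathbb R^d$ with the maximum norm $\|\varphi\|=\max_{\theta\in[-r,0]}|\varphi(\theta)|$, where $|\cdot|$ is an arbitrary norm on $\mathbb R^d$; $\mathcal C^1$ is the analogous space of continuously differentiable functions. For a function $u$, $u_t(\theta)=u(t+\theta)$, $\theta\in[-r,0]$. Dots denote time derivatives; a prime on $b'$, $\eta'$, $E'$ is part of the name and does not mean differentiation. Problem. The second order retarded functional differential equation is $\ddot u(t)=f(t,u_t)$, where $u_t\in\mathcal C^1$, $f:\Omega\to\mathbb R^d$, $\Omega$ is an open subset of $\mathbb R\times\mathcal C^1$, $f$ is continuous and has a derivative $f':\Omega\to\mathcal L(\mathcal C^1,\mathbb R^d)$ with respect to the second argument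 (here the prime does mean derivative) which is bounded and continuous with respect to the second argument. For each $(\sigma,\varphi)\in\Omega$ there is a unique non-continuable solution $u:[\sigma-r,\bar t)\to\mathbb R^d$ through $(\sigma,\varphi)$, i.e. $u$ satisfies the equation for $t\in[\sigma,\bar t)$ and $u_\sigma=\varphi$. Since the right-hand side does not depend on $\dot u$, nothing further is required of $\dot\varphi$ except the existence of the initial value $\dot\varphi(0)$. Method. An explicit $s$-stage functional continuous Runge--Kutta--Nyström (FCRKN) method is a quadruple $(A(\cdot),b(\cdot),b'(\cdot),c)$, where $A(\cdot)=(a_{ij}(\cdot))$ is a strictly lower-triangular $\mathbb R^{s\times s}$-valued polynomial function with $A(0)=0$, $b(\cdot)=(b_i(\cdot))$ and $b'(\cdot)=(b'_i(\cdot))$ are $\mathbb R^s$-valued polynomial functions with $b(0)=b'(0)=0$, and $c\in\mathbb R^s$ with $c_1=0$, $c_i\ge0$ for $i=2,\dots,s$. Applied with stepsize $h$ to get the solution $u$ through $(\sigma,\varphi)$, it gives for $\alpha\in[0,1]$ $$\eta(\alpha h)=\varphi(0)+\alpha h\dot\varphi(0)+h^2\sum_{i=1}^s b_i(\alpha)K_i,\qquad \eta'(\alpha h)=\dot\varphi(0)+h\sum_{i=1}^s b'_i(\alpha)K_i,$$ where $K_i=f(\sigma+c_ih,Y^i_{c_ih})$ and the stage functions $Y^i:[-r,c_ih]\to\mathbb R^d$ are given by $Y^i(\alpha h)=\varphi(0)+\alpha h\dot\varphi(0)+h^2\sum_{j=1}^{i-1}a_{ij}(\alpha)K_j$ for $\alpha\in[0,c_i]$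 and $Y^i(\theta)=\varphi(\theta)$ for $\theta\in[-r,0]$. With $y=u(\sigma+\cdot)$, the local errors on $[0,h]$ are $E=\eta-y$ and $E'=\eta'-\dot y$. Order. The method has (local) uniform order $p$ if, for a sufficiently smooth problem $\ddot u(t)=f(t,u_t)$, for $h$ small enough there exist some $C>0$ and $C'>0$ such that $\max_{\alpha\in[0,1]}\|E(\alpha h)\|\le Ch^{p+1}$ and $\max_{\alpha\in[0,1]}\|E'(\alpha h)\|\le C'h^{p+1}$. It has (local) discrete order $q$ if, likewise, $\|E(h)\|\le Ch^{q+1}$ and $\|E'(h)\|\le C'h^{q+1}$.
   Formalization: Piecewise C^3 alone gives only E' = o(h^2), so order is required only of solutions u of some sufficiently high finite piecewise class C^k; since stage functions Y^i may have a kink and leave C^1, K_i is the value of the continuous extension of f in the maximum norm of values. *)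

(* Defs.v *)
From HB Require Import structures.
From mathcomp Require Import all_boot all_order all_algebra.
From mathcomp Require Import all_classical all_reals all_analysis.

Set Implicit Arguments.
Unset Strict Implicit.
Unset Printing Implicit Defensive.

Import Order.TTheory GRing.Theory Num.Theory.
Import numFieldNormedType.Exports.

Local Open Scope classical_set_scope.
Local Open Scope ring_scope.

Section Calculus.
Context {R : realType} {d : nat}.
Implicit Types (N : 'rV[R]_d -> R) (A : set R) (g dg : R -> 'rV[R]_d).

Definition is_norm N : Prop :=
  [/\ forall x, N x = 0 -> x = 0,
      forall x y, N (x + y) <= N x + N y &
      forall (k : R) x, N (k *: x) = `|k| * N x].

(* One-sided at an endpoint of an interval A; when A = {x} the filter is
   trivial and every l qualifies. *)
Definition deriv_at A g (x : R) (l : 'rV[R]_d) : Prop :=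
  (y - x)^-1 *: (g y - g x) @[y --> within A x^'] --> l.

Definition deriv_on A g dg : Prop := forall x, A x -> deriv_at A g x (dg x).

Fixpoint class_C (k : nat) A g : Prop :=
  if k is k'.+1 then exists2 dg, deriv_on A g dg & class_C k' A dg
  else {within A, continuous g}.

(* On every compact subinterval [a, b] of the interval A there are finitely
   many breakpoints a = t_0 < t_1 < ... < t_n = b such that g is of class C^k
   on each closed piece [t_i, t_{i+1}], with one-sided derivatives at both
   ends of the piece. *)
Definition piecewise_C (k : nat) A g : Prop :=
  forall a b : R, A a -> A b -> a <= b ->
  exists t : seq R, [/\ path <%R a t, last a t = b &
    forall i, (i < size t)%N ->
      class_C k `[nth 0 (a :: t) i, nth 0 (a :: t) i.+1] g].

Definition bounded_on N A g : Prop := exists B : R, forall x, A x -> N (g x) <= B.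

End Calculus.

Section RetardedProblem.
Context {R : realType} {d : nat}.
Variables (r : \bar R) (N : 'rV[R]_d -> R).

(* [-r, 0], read as ]-oo, 0] when r = +oo *)
Definition delay_itv : set R := [set th | (- r <= th%:E)%E /\ th <= 0].

(* A function on [-r, 0] is represented by its extension by 0 to R. *)
Definition hist (x : R -> 'rV[R]_d) (t : R) : R -> 'rV[R]_d :=
  patch (fun=> 0) delay_itv (fun th => x (t + th)).

(* The two bounds follow from continuity when r is finite; for r = +oo they
   make the maximum norms of phi and of its derivative finite. *)
Definition C1_space : set (R -> 'rV[R]_d) :=
  [set phi | (forall th, ~ delay_itv th -> phi th = 0) /\
     exists dphi, [/\ deriv_on delay_itv phi dphi,
       {within delay_itv, continuous dphi},
       bounded_on N delay_itv phi & bounded_on N delay_itv dphi]].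

(* The space C1_space carries this maximum norm of the values, not a norm
   involving the derivative: the right-hand side does not depend on the
   derivative of the solution. *)
Definition max_norm (phi : R -> 'rV[R]_d) : R :=
  sup [set N (phi th) | th in delay_itv].

(* rhs t phi is meaningful only for (t, phi) in dom. *)
Record problem := Problem {
  dom : set (R * (R -> 'rV[R]_d));
  rhs : R -> (R -> 'rV[R]_d) -> 'rV[R]_d;
  dom_C1 : forall t phi, dom (t, phi) -> C1_space phi;
  dom_open : forall t phi, dom (t, phi) -> exists2 e : R, 0 < e &
    forall s psi, `|s - t| < e -> C1_space psi -> max_norm (psi - phi) < e ->
      dom (s, psi);
  rhs_cont : forall t phi, dom (t, phi) -> forall e : R, 0 < e ->
    exists2 dl : R, 0 < dl &
    forall s psi, dom (s, psi) -> `|s - t| < dl -> max_norm (psi - phi) < dl ->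
      N (rhs s psi - rhs t phi) < e }.

(* The four clauses: Df t phi is linear on C1_space; it is the Frechet
   derivative of rhs t at phi; the operator norms are bounded on dom; and
   Df t is continuous for the operator norm. *)
Definition rhs_class_C1 (pb : problem) : Prop :=
  exists Df : R -> (R -> 'rV[R]_d) -> (R -> 'rV[R]_d) -> 'rV[R]_d,
  [/\ forall t phi, dom pb (t, phi) -> forall (k : R) chi psi,
        C1_space chi -> C1_space psi ->
        Df t phi (k *: chi + psi) = k *: Df t phi chi + Df t phi psi,
      forall t phi, dom pb (t, phi) -> forall e : R, 0 < e ->
        exists2 dl : R, 0 < dl & forall chi, C1_space chi ->
          max_norm chi < dl -> dom pb (t, phi + chi) ->
          N (rhs pb t (phi + chi) - rhs pb t phi - Df t phi chi)
            <= e * max_norm chi,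
      exists B : R, forall t phi chi, dom pb (t, phi) -> C1_space chi ->
        N (Df t phi chi) <= B * max_norm chi &
      forall t phi, dom pb (t, phi) -> forall e : R, 0 < e ->
        exists2 dl : R, 0 < dl & forall psi, dom pb (t, psi) ->
          max_norm (psi - phi) < dl -> forall chi, C1_space chi ->
          N (Df t psi chi - Df t phi chi) <= e * max_norm chi].

(* k is the value at (t, Y) of the continuous extension of rhs to the
   continuous functions Y on [-r, 0]; it is rhs t Y if Y is in C1_space.
   Stage functions have in general a kink where the initial function ends, so
   they only belong to the closure of C1_space. *)
Definition rhs_value (pb : problem) (t : R) (Y : R -> 'rV[R]_d) (k : 'rV[R]_d)
    : Prop :=
  (exists2 e : R, 0 < e & forall chi, C1_space chi ->
     max_norm (chi - Y) < e -> dom pb (t, chi)) /\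
  (forall e : R, 0 < e -> exists2 dl : R, 0 < dl & forall chi, C1_space chi ->
     max_norm (chi - Y) < dl -> dom pb (t, chi) -> N (rhs pb t chi - k) < e).

Definition forward_itv (sigma : R) (tbar : \bar R) : set R :=
  [set t | sigma <= t /\ (t%:E < tbar)%E].

Definition solution_itv (sigma : R) (tbar : \bar R) : set R :=
  [set t | (sigma%:E - r <= t%:E)%E /\ (t%:E < tbar)%E].

(* u is a solution on [sigma - r, tbar[ through (sigma, phi) and du is its
   derivative on [sigma, tbar[.  The initial slope v0 is the left derivative
   of phi at 0; if r = 0 it is not determined by phi and is extra data. *)
Definition solution (pb : problem) (sigma : R) (phi : R -> 'rV[R]_d)
    (v0 : 'rV[R]_d) (tbar : \bar R) (u du : R -> 'rV[R]_d) : Prop :=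
  [/\ dom pb (sigma, phi), deriv_at delay_itv phi 0 v0, (sigma%:E < tbar)%E,
      hist u sigma = phi &
    exists ddu, [/\ deriv_on (forward_itv sigma tbar) u du,
      deriv_on (forward_itv sigma tbar) du ddu, du sigma = v0 &
      forall t, forward_itv sigma tbar t ->
        dom pb (t, hist u t) /\ ddu t = rhs pb t (hist u t)]].

Definition noncontinuable (pb : problem) (sigma : R) (phi : R -> 'rV[R]_d)
    (v0 : 'rV[R]_d) (tbar : \bar R) (u : R -> 'rV[R]_d) : Prop :=
  ~ exists tbar' u' du', [/\ (tbar < tbar')%E,
      solution pb sigma phi v0 tbar' u' du' &
      forall t, solution_itv sigma tbar t -> u' t = u t].

End RetardedProblem.

(* fb and fdb are the weights b(.) and b'(.) of the method. *)
Record fcrkn (R : realType) (s : nat) := FCRKN {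
  fa : 'I_s -> 'I_s -> {poly R};
  fb : 'I_s -> {poly R};
  fdb : 'I_s -> {poly R};
  fc : 'I_s -> R;
  fa_explicit : forall i j : 'I_s, (i <= j)%N -> fa i j = 0;
  fa0 : forall i j, (fa i j).[0] = 0;
  fb0 : forall i, (fb i).[0] = 0;
  fdb0 : forall i, (fdb i).[0] = 0;
  fc_first : forall i : 'I_s, i = 0%N :> nat -> fc i = 0;
  fc_ge0 : forall i, 0 <= fc i }.

Section Method.
Context {R : realType} {d s : nat}.
Variables (r : \bar R) (N : 'rV[R]_d -> R) (M : fcrkn R s).
Implicit Types (phi : R -> 'rV[R]_d) (K : 'I_s -> 'rV[R]_d).

Definition stage_fun phi (v0 : 'rV[R]_d) (h : R) K (i : 'I_s) (x : R) : 'rV[R]_d :=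
  if x <= 0 then phi x else
  phi 0 + x *: v0 + h ^+ 2 *: \sum_(j < s | (j < i)%N) (fa M i j).[x / h] *: K j.

Definition stages (pb : problem r N) (sigma : R) phi (v0 : 'rV[R]_d) (h : R) K
    : Prop :=
  forall i, rhs_value pb (sigma + fc M i * h)
              (hist r (stage_fun phi v0 h K i) (fc M i * h)) (K i).

Definition eta phi (v0 : 'rV[R]_d) (h : R) K (alpha : R) : 'rV[R]_d :=
  phi 0 + (alpha * h) *: v0 + h ^+ 2 *: \sum_(i < s) (fb M i).[alpha] *: K i.

Definition deta (v0 : 'rV[R]_d) (h : R) K (alpha : R) : 'rV[R]_d :=
  v0 + h *: \sum_(i < s) (fdb M i).[alpha] *: K i.

(* The local errors are O(h^(p+1)) for alpha in I.  The values K are uniquely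
   determined by h for an explicit method; their existence, i.e. that the
   method can be applied with stepsize h, is part of the statement. *)
Definition local_order (p : nat) (I : set R) (pb : problem r N) (sigma : R)
    phi (v0 : 'rV[R]_d) (u du : R -> 'rV[R]_d) : Prop :=
  exists h0 C C' : R, [/\ 0 < h0, 0 < C, 0 < C' &
    forall h, 0 < h < h0 -> exists2 K, stages pb sigma phi v0 h K &
      forall alpha, I alpha ->
        N (eta phi v0 h K alpha - u (sigma + alpha * h)) <= C * h ^+ p.+1 /\
        N (deta v0 h K alpha - du (sigma + alpha * h)) <= C' * h ^+ p.+1].

(* S pb sigma tbar u restricts the problems and solutions considered.
   `Sufficiently smooth' is expressed by the existence of a finite smoothness
   level k of the solution. *)
Definition has_order (S : problem r N -> R -> \bar R -> (R -> 'rV[R]_d) -> Prop)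
    (p : nat) (I : set R) : Prop :=
  exists k : nat, forall (pb : problem r N) sigma phi v0 tbar u du,
    solution pb sigma phi v0 tbar u du ->
    noncontinuable pb sigma phi v0 tbar u ->
    S pb sigma tbar u ->
    piecewise_C k (solution_itv r sigma tbar) u ->
    local_order p I pb sigma phi v0 u du.

Definition uniform_order S p := has_order S p `[0, 1].

Definition discrete_order S p := has_order S p [set 1].

End Method.

(* Main.v *)
Require Import Defs.
From mathcomp Require Import all_boot all_order all_algebra.
From mathcomp Require Import all_classical all_reals all_analysis.
From mathcomp Require Import ring lra.

(** The stage values [K_i] of the method approximate the second derivative of
    the solution [u] at [sigma + c_i h], and [deta] is a quadrature of that
    second derivative with nodes [c_i] and weights [b'_i(alpha)]. Everything
    follows from how well this quadrature treats the expansion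
    [u''(sigma + x) = u''(sigma) + x w + O(x^2)], where [w] is the one-sided
    third derivative at [sigma].

    Sufficiency ([order_two_sufficient]). A piecewise smooth solution is smooth
    on some [[sigma, sigma + T]] ([first_piece]), where [class_C4_taylor] gives
    the expansions. Stage function and solution share value and slope at
    [sigma], hence differ by [O(h^2)] ([stage_close]); since the right-hand side
    has a bounded derivative it is Lipschitz on a ball of histories
    ([rhs_lipschitz]), so [K_i = u''(sigma + c_i h) + O(h^2)] ([stages_close]).
    Stage functions have in general a kink at [sigma], hence are not admissible
    histories; the value of the right-hand side there is a limit, which exists
    by completeness ([rhs_value_near]). Then the error of [deta] is
    [h^2 (sum_i b'_i c_i - alpha^2 / 2) w + O(h^3)], and the condition removes
    the first term ([deta_error]). The error of [eta] carries another factor [h]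
    and is [O(h^3)] as soon as the [b_i] sum to [alpha^2 / 2] ([eta_error]). The
    argument is pointwise in [alpha], so the uniform and the discrete statement
    are the same statement for two sets of [alpha].

    Necessity ([order_two_necessary]). For [u'' = t v] with zero history at time
    0, the stage values are exactly [c_i h v], and the error of [deta] is exactly
    [h^2 (sum_i b'_i c_i - alpha^2 / 2) v]. It is [O(h^3)] only if the bracket
    vanishes ([order_two_on_ramp]). The solution is a cubic of the ramp
    [max(t, 0)], piecewise smooth of every order, so that no smoothness
    requirement rules it out. The delicate point is that [K_i] is defined by a
    limit over admissible histories; [ramp_poly_approx] smooths the kink of the
    stage functions to show that such histories exist. *)

Set Implicit Arguments.
Unset Strict Implicit.
Unset Printing Implicit Defensive.

Import Order.TTheory GRing.Theory Num.Theory.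
Import numFieldNormedType.Exports.

Local Open Scope classical_set_scope.
Local Open Scope ring_scope.

(** * Norms on row vectors *)

Section Norm.
Context {R : realType} {d : nat} (N : 'rV[R]_d -> R).
Hypothesis N_norm : is_norm N.

Lemma is_norm_eq0 x : N x = 0 -> x = 0.
Proof. by case: N_norm => + _ _; exact. Qed.

Lemma is_normD x y : N (x + y) <= N x + N y.
Proof. by case: N_norm. Qed.

Lemma is_normZ (k : R) x : N (k *: x) = `|k| * N x.
Proof. by case: N_norm. Qed.

Lemma is_norm0 : N 0 = 0.
Proof. by rewrite -(scale0r (0 : 'rV[R]_d)) is_normZ normr0 mul0r. Qed.

Lemma is_normN x : N (- x) = N x.
Proof. by rewrite -scaleN1r is_normZ normrN1 mul1r. Qed.

Lemma is_norm_ge0 x : 0 <= N x.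
Proof. by have := is_normD x (- x); rewrite subrr is_norm0 is_normN; lra. Qed.

Lemma is_normB x y : N (x - y) = N (y - x).
Proof. by rewrite -is_normN opprB. Qed.

Lemma is_norm_triangle y x z : N (x - z) <= N (x - y) + N (y - z).
Proof. by apply: le_trans (is_normD _ _); rewrite addrA subrK. Qed.

Lemma is_norm_sum (I : finType) (P : pred I) (F : I -> 'rV[R]_d) :
  N (\sum_(i | P i) F i) <= \sum_(i | P i) N (F i).
Proof.
elim/big_ind2 : _ => [|u a v b ua vb|//]; first by rewrite is_norm0.
by apply: le_trans (is_normD _ _) _; exact: lerD.
Qed.

(** Derivatives and continuity are taken in the topology of the maximum norm
    of [matrix], while errors are measured with [N]; this lemma and
    [mx_norm_le_is_norm] pass from one to the other. *)
Lemma is_norm_le_mx_norm : exists2 c : R, 0 < c & forall x, N x <= c * `|x|.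
Proof.
exists (1 + \sum_(j < d) N (delta_mx 0 j)) => [|x].
  by apply: ltr_pwDl => //; apply: sumr_ge0 => j _; exact: is_norm_ge0.
rewrite {1}(row_sum_delta x) mulrDl mul1r mulr_suml.
apply: le_trans (is_norm_sum _ _) _.
apply: ler_wpDl => //; apply: ler_sum => j _; rewrite is_normZ mulrC.
apply: ler_wpM2l; first exact: is_norm_ge0.
rewrite [leRHS]/Num.norm /= mx_normrE.
exact: (le_bigmax _ (fun ij : 'I_1 * 'I_d => `|x ij.1 ij.2|) (0, j)).
Qed.

Lemma is_norm_continuous : continuous N.
Proof.
move=> x; apply/(@cvgrPdist_lt _ _ _ (nbhs x)) => e e0.
have [c c0 Nc] := is_norm_le_mx_norm.
near=> y.
have xy : N (x - y) < e.
  apply: le_lt_trans (Nc _) _; rewrite mulrC -ltr_pdivlMr//.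
  by near: y; apply: cvgr_dist_lt => //; rewrite divr_gt0.
have := is_norm_triangle y x 0; have := is_norm_triangle x y 0.
rewrite !subr0 (is_normB y x) => ? ?.
by rewrite ltr_norml; lra.
Unshelve. all: by end_near. Qed.

(** [N] attains a minimum on the unit sphere of the maximum norm, by
    compactness, and this minimum is positive because [N] is definite. *)
Lemma mx_norm_le_is_norm : exists2 c : R, 0 < c & forall x, `|x| <= c * N x.
Proof.
pose S := [set x : 'rV[R]_d | `|x| = 1].
have [[x0 Sx0]|S0] := pselect (S !=set0); last first.
  exists 1 => // x; have [->|x0] := eqVneq x 0.
    by rewrite normr0 mul1r is_norm_ge0.
  exfalso; apply: S0; exists (`|x|^-1 *: x).
  by rewrite /S/= normrZ normfV normr_id mulVf// normr_eq0.
have cS : compact S.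
  apply: bounded_closed_compact.
    by exists 1; split=> // y y1 x /= ->; exact: ltW.
  have -> : S = Num.norm @^-1` [set 1] by [].
  by apply: closed_comp; [move=> x _; exact: norm_continuous | exact: closed_eq].
have [|c] := @compact_EVT_min _ _ N S (ex_intro _ x0 Sx0) cS.
  by apply: continuous_subspaceT; exact: is_norm_continuous.
rewrite inE => Sc Nmin.
have Nc0 : 0 < N c.
  rewrite lt_neqAle is_norm_ge0 andbT eq_sym; apply/eqP => /is_norm_eq0 c0.
  by move: Sc; rewrite c0 /S/= normr0 => /eqP; rewrite eq_sym oner_eq0.
exists (N c)^-1; first by rewrite invr_gt0.
move=> x; have [->|x_neq0] := eqVneq x 0; first by rewrite normr0 is_norm0 mulr0.
rewrite mulrC ler_pdivlMr//.
have := Nmin (`|x|^-1 *: x); rewrite inE is_normZ normfV normr_id => /(_ _).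
rewrite mulrC ler_pdivlMr ?normr_gt0// mulrC; apply.
by rewrite /S/= normrZ normfV normr_id mulVf// normr_eq0.
Qed.

End Norm.

Lemma is_norm_complete (R : realType) (d : nat) (N : 'rV[R]_d -> R)
    (z : nat -> 'rV[R]_d) : is_norm N ->
  (forall e : R, 0 < e -> exists n0, forall n, (n0 <= n)%N -> N (z n0 - z n) < e) ->
  exists k, forall e : R, 0 < e -> exists n0, forall n, (n0 <= n)%N -> N (z n - k) < e.
Proof.
move=> N_norm cauchy_z.
have [c c0 Nc] := is_norm_le_mx_norm N_norm.
have [c' c'0 Nc'] := mx_norm_le_is_norm N_norm.
have zk : cvg (z @ \oo).
  apply: cauchy_cvg; apply: cauchy_exP => e e0.
  have [n0 n0e] := cauchy_z (e / c') (divr_gt0 e0 c'0).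
  exists (z n0); exists n0 => //= n /= n0n.
  rewrite -ball_normE /ball_/=; apply: le_lt_trans (Nc' _) _.
  by rewrite mulrC -ltr_pdivlMr//; exact: n0e.
exists (lim (z @ \oo)) => e e0.
have ec : 0 < e / c by rewrite divr_gt0.
move/(@cvgrPdist_lt _ _ _ (nbhs \oo)) : zk => /(_ _ ec)[n0 _ n0e].
exists n0 => n n0n; apply: le_lt_trans (Nc _) _.
by rewrite mulrC -ltr_pdivlMr// distrC; exact: n0e.
Qed.

(** * One-sided derivatives in an arbitrary norm *)

Section Derivative.
Context {R : realType} {d : nat} (N : 'rV[R]_d -> R).
Hypothesis N_norm : is_norm N.
Implicit Types (A : set R) (g dg : R -> 'rV[R]_d).

(** The first order expansion with the difference quotient multiplied out:
    an estimate that also holds at the point [x] itself, and in which the norm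
    [N] of the problem has replaced the topology. *)
Lemma deriv_atP A g x l : deriv_at A g x l <->
  forall e : R, 0 < e -> exists2 dl : R, 0 < dl &
    forall y, A y -> `|y - x| < dl -> N (g y - g x - (y - x) *: l) <= e * `|y - x|.
Proof.
have factor y : y != x -> g y - g x - (y - x) *: l =
    (y - x) *: ((y - x)^-1 *: (g y - g x) - l).
  by move=> yx; rewrite scalerBr scalerA divff ?subr_eq0// scale1r.
split=> [gl e e0|gl].
  have [c c0 Nc] := is_norm_le_mx_norm N_norm.
  have ec : 0 < e / c by rewrite divr_gt0.
  move/(@cvgrPdist_le _ _ _ (within A x^')): gl => /(_ _ ec).
  rewrite near_withinE near_withinE => /nbhs_ballP[dl /= dl0 near_x].
  exists dl => // y Ay yx; have [->|y_neq_x] := eqVneq y x.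
    by rewrite !subrr scale0r subr0 is_norm0// normr0 mulr0.
  rewrite factor// is_normZ// mulrC ler_wpM2r// is_normB//.
  have xy : ball x dl y by rewrite /ball/= distrC.
  apply: le_trans (Nc _) _; rewrite mulrC -ler_pdivlMr//.
  exact: near_x xy y_neq_x Ay.
have [c c0 Nc] := mx_norm_le_is_norm N_norm.
apply/(@cvgrPdist_le _ _ _ (within A x^')) => e e0.
have ec : 0 < e / c by rewrite divr_gt0.
have [dl dl0 near_x] := gl _ ec.
rewrite near_withinE near_withinE; apply/nbhs_ballP; exists dl => //= y.
rewrite /ball/= distrC => yx y_neq_x Ay.
apply: le_trans (Nc _) _; rewrite mulrC -ler_pdivlMr// is_normB//.
have yx0 : 0 < `|y - x| by rewrite normr_gt0 subr_eq0.
rewrite -(ler_pM2r yx0); apply: le_trans (near_x y Ay yx).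
by rewrite factor// is_normZ// mulrC.
Qed.

Lemma deriv_at_sub A B g x l : B `<=` A -> deriv_at A g x l -> deriv_at B g x l.
Proof.
move=> BA /deriv_atP gl; apply/deriv_atP => e /gl[dl dl0 near_x].
by exists dl => // y /BA; exact: near_x.
Qed.

Lemma eq_deriv_at A g1 g2 x l : (forall y, A y -> g1 y = g2 y) -> A x ->
  deriv_at A g1 x l -> deriv_at A g2 x l.
Proof.
move=> g12 Ax /deriv_atP gl; apply/deriv_atP => e /gl[dl dl0 near_x].
by exists dl => // y Ay; rewrite -!g12//; exact: near_x.
Qed.

Lemma deriv_at_lin A g1 g2 x l1 l2 (k : R) :
  deriv_at A g1 x l1 -> deriv_at A g2 x l2 ->
  deriv_at A (k *: g1 + g2) x (k *: l1 + l2).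
Proof.
move=> gl1 gl2; rewrite /deriv_at.
have -> : (fun y => (y - x)^-1 *: ((k *: g1 + g2) y - (k *: g1 + g2) x)) =
    (fun y => k *: ((y - x)^-1 *: (g1 y - g1 x)) + (y - x)^-1 *: (g2 y - g2 x)).
  apply/funext => y.
  have E z : (k *: g1 + g2) z = k *: g1 z + g2 z by [].
  rewrite !E [k *: (_ *: _)]scalerA [k * _]mulrC.
  by rewrite -scalerA -scalerDr [k *: (g1 y - _)]scalerBr opprD addrACA.
by apply: cvgD gl2; apply: cvgZr.
Qed.

(** At every point of a nondegenerate interval, endpoints included, there are
    points of the interval arbitrarily close on one side. This is what
    identifies the derivatives supplied by the smoothness class of a solution
    with those supplied by the differential equation. *)
Lemma deriv_at_unique (a b : R) g x l1 l2 : a < b -> `[a, b]%classic x ->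
  deriv_at `[a, b] g x l1 -> deriv_at `[a, b] g x l2 -> l1 = l2.
Proof.
move=> ab; rewrite /= in_itv/= => /andP[ax xb] /deriv_atP gl1 /deriv_atP gl2.
apply/eqP; rewrite -subr_eq0; apply/eqP/(is_norm_eq0 N_norm)/eqP.
rewrite eq_le is_norm_ge0// andbT; apply/ler_addgt0Pr => e e0; rewrite add0r.
have e2 : 0 < e / 2 by rewrite divr_gt0.
have [d1 d10 near1] := gl1 _ e2; have [d2 d20 near2] := gl2 _ e2.
have [y [yab yx yd1 yd2]] : exists y, [/\ `[a, b]%classic y, 0 < `|y - x|,
    `|y - x| < d1 & `|y - x| < d2].
  pose mn := Num.min (Num.min d1 d2) (b - a).
  have mn0 : 0 < mn by rewrite !lt_min d10 d20/= subr_gt0.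
  have /andP[/andP[mn1 mn2] mnab] : (mn <= d1) && (mn <= d2) && (mn <= b - a).
    by rewrite -!le_min.
  pose m := mn / 2.
  have [m0 m1 m2 mab] : [/\ 0 < m, m < d1, m < d2 & m <= (b - a) / 2].
    by rewrite /m; split; lra.
  have [xm|xm] := leP x ((a + b) / 2).
    exists (x + m); rewrite addrAC subrr add0r gtr0_norm//; split=> //=.
    by rewrite in_itv/=; lra.
  exists (x - m); rewrite addrAC subrr add0r normrN gtr0_norm//; split=> //=.
  by rewrite in_itv/=; lra.
rewrite -(ler_pM2l yx) -is_normZ//.
have := is_norm_triangle N_norm (g y - g x) ((y - x) *: l1) ((y - x) *: l2).
have := near1 y yab yd1; have := near2 y yab yd2; rewrite -scalerBr.
rewrite [N ((y - x) *: _)](_ : _ = `|y - x| * N (l1 - l2)); last exact: is_normZ.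
rewrite (is_normB N_norm ((y - x) *: l1))//.
by move: (N _) (N _) (N (l1 - l2)) => p q s; nra.
Qed.

End Derivative.

(** * Mean value inequality and Taylor estimates *)

Section MeanValue.
Context {R : realType} {d : nat} (N : 'rV[R]_d -> R).
Hypothesis N_norm : is_norm N.
Implicit Types (A : set R) (g dg : R -> 'rV[R]_d).

(** A mean value inequality for an arbitrary norm, which asks only for a
    pointwise Lipschitz estimate. The set of the [x] up to which the bound
    [(L + e) * (x - a)] holds contains its supremum, and could be enlarged if
    the supremum were not [b]. It applies both to functions with one-sided
    derivatives and to the right-hand side along a segment of histories. *)
Lemma mean_value_local (g : R -> 'rV[R]_d) (a b L : R) : a <= b ->
  (forall x, a <= x <= b -> forall e, 0 < e -> exists2 dl, 0 < dl &
     forall y, a <= y <= b -> `|y - x| < dl -> N (g y - g x) <= (L + e) * `|y - x|) ->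
  N (g b - g a) <= L * (b - a).
Proof.
move=> ab local; apply/ler_addgt0Pr => e0 e00.
(* [b - a + 1] in place of [b - a] covers the degenerate interval. *)
have [e e_gt0 le_e] : exists2 e, 0 < e & e * (b - a) <= e0.
  have ba : 0 < b - a + 1 by lra.
  exists (e0 / (b - a + 1)); first exact: divr_gt0.
  by rewrite mulrAC ler_pdivrMr// ler_pM2l//; lra.
suff : N (g b - g a) <= (L + e) * (b - a) by nra.
pose S := [set x | a <= x <= b /\ N (g x - g a) <= (L + e) * (x - a)].
have Sa : S a by split; rewrite ?lexx// !subrr is_norm0// mulr0.
have S_step x y : S x -> x <= y <= b ->
    N (g y - g x) <= (L + e) * (y - x) -> S y.
  move=> [xab Nx] xy Nxy; split; first lra.
  have := is_norm_triangle N_norm (g x) (g y) (g a).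
  by move: Nx Nxy; move: (N _) (N _) (N _) => p q s; lra.
have ubS : ubound S b by move=> x [/andP[]].
have supS : has_sup S by split; [exists a | exists b].
have acb : a <= sup S <= b.
  by rewrite sup_upper_bound// ge_sup//; exists a.
have [dl dl0 near_c] := local _ acb _ e_gt0.
have Sc : S (sup S).
  have [y Sy yc] := sup_adherent dl0 supS.
  have yc' : y <= sup S by exact: sup_upper_bound.
  apply: (S_step y) => //; first by lra.
  have := near_c y; rewrite distrC is_normB// ger0_norm ?subr_ge0//; apply; last by lra.
  by case: Sy.
have [cb|] := ltP (sup S) b; last first.
  by move=> bc; have <- : sup S = b; [lra|case: Sc].
(* Otherwise the bound would persist a little beyond the supremum. *)
have [m [m0 mdl mb]] : exists m, [/\ 0 < m, m < dl & m <= b - sup S].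
  have [h|h] := leP dl (b - sup S); first by exists (dl / 2); split; lra.
  by exists (b - sup S); split; lra.
suff : S (sup S + m) by move=> /(sup_upper_bound supS); lra.
apply: (S_step (sup S)) => //; first by lra.
have := near_c (sup S + m).
by rewrite addrAC subrr add0r gtr0_norm//; apply; lra.
Qed.

Lemma mean_value g dg (a b L : R) : a <= b ->
  deriv_on `[a, b] g dg -> (forall x, a <= x <= b -> N (dg x) <= L) ->
  N (g b - g a) <= L * (b - a).
Proof.
move=> ab gdg dgL; apply: mean_value_local => // x xab e e0.
have /(deriv_atP N_norm)/(_ e e0)[dl dl0 near_x] : deriv_at `[a, b] g x (dg x).
  by apply: gdg; rewrite /= in_itv.
exists dl => // y yab yx.
have {}near_x : N (g y - g x - (y - x) *: dg x) <= e * `|y - x|.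
  by apply: near_x => //; rewrite /= in_itv.
have := is_normD N_norm (g y - g x - (y - x) *: dg x) ((y - x) *: dg x).
rewrite subrK is_normZ// => /le_trans; apply.
rewrite mulrDl addrC lerD// mulrC ler_wpM2r//; exact: dgL.
Qed.

Lemma deriv_lipschitz A g dg (L : R) : (forall x y, A x -> A y -> `[x, y] `<=` A) ->
  deriv_on A g dg -> (forall x, A x -> N (dg x) <= L) ->
  forall x y, A x -> A y -> N (g y - g x) <= L * `|y - x|.
Proof.
move=> itvA gdg dgL x y.
wlog xy : x y / x <= y => [th Ax Ay|Ax Ay].
  have [/th|/ltW/th] := leP x y; first exact.
  by rewrite is_normB// distrC; exact.
have sub := itvA _ _ Ax Ay.
rewrite ger0_norm ?subr_ge0//; apply: (@mean_value g dg) => //.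
  by move=> z xzy; apply: (deriv_at_sub N_norm sub); apply: gdg; exact: sub.
by move=> z xzy; apply: dgL; apply: sub; rewrite /= in_itv.
Qed.

Lemma itv_cc_convex (a b x y : R) :
  `[a, b]%classic x -> `[a, b]%classic y -> `[x, y] `<=` `[a, b].
Proof.
rewrite /= !in_itv/= => xab yab z; rewrite /= !in_itv/=.
by move: xab yab => /andP[? ?] /andP[? ?] /andP[? ?]; lra.
Qed.

(** A remainder of second order is a convenient certificate for a derivative:
    it is checked by algebra, even at a kink of a higher derivative. *)
Lemma deriv_at_quadratic A g (x C : R) l :
  (forall y, A y -> `|y - x| <= 1 ->
     N (g y - g x - (y - x) *: l) <= C * `|y - x| ^+ 2) ->
  deriv_at A g x l.
Proof.
move=> gC; apply/(deriv_atP N_norm) => e e0.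
have C0 : 0 < `|C| + 1 by apply: ltr_wpDl.
exists (Num.min 1 (e / (`|C| + 1))) => [|y Ay].
  by rewrite lt_min ltr01 divr_gt0.
rewrite lt_min ltr_pdivlMr// => /andP[/ltW yx1 yxe].
apply: le_trans (gC y Ay yx1) _; rewrite expr2 mulrA ler_wpM2r//.
have := ler_norm C; have := normr_ge0 (y - x).
by move: `|C| C0 yxe yx1 => c; move: `|y - x| => z; nra.
Qed.

(** Integration of an estimate without integrals: the mean value inequality on
    [[a, x]], where [(y - a) ^+ n] is at most [(x - a) ^+ n], costs only the
    optimal constant and gains one power. Iterating it gives Taylor's formula
    with one-sided derivatives. *)
Lemma integrate_estimate g dg p dp (a b L : R) (n : nat) :
  deriv_on `[a, b] g dg -> deriv_on `[a, b] p dp -> 0 <= L ->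
  (forall x, a <= x <= b -> N (dg x - dp x) <= L * (x - a) ^+ n) ->
  forall x, a <= x <= b -> N (g x - g a - (p x - p a)) <= L * (x - a) ^+ n.+1.
Proof.
move=> gdg pdp L0 dgdp x /andP[ax xb]; rewrite exprSr mulrA.
have -> : g x - g a - (p x - p a) = (-1 *: p + g) x - (-1 *: p + g) a.
  have E z : (-1 *: p + g) z = g z - p z.
    by rewrite -[LHS]/(-1 *: p z + g z) scaleN1r addrC.
  by rewrite !E; apply/rowP => j; rewrite !mxE; ring.
apply: (@mean_value _ (-1 *: dp + dg)) => //.
  move=> y; rewrite /= in_itv/= => /andP[ay yx].
  apply: deriv_at_lin; apply: (@deriv_at_sub _ _ N N_norm `[a, b]);
    [| apply: pdp | | apply: gdg]; rewrite /= ?in_itv/=; try lra;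
    by move=> z; rewrite /= !in_itv/=; lra.
move=> y /andP[ay yx]; rewrite -[(_ + _) y]/(-1 *: dp y + dg y).
rewrite scaleN1r addrC; apply: le_trans (dgdp y _) _; first lra.
by rewrite ler_wpM2l// lerXn2r// ?nnegrE; lra.
Qed.

Lemma within_continuous_bounded g (a b : R) : a <= b ->
  {within `[a, b], continuous g} -> exists2 L, 0 <= L & forall x, a <= x <= b -> N (g x) <= L.
Proof.
move=> ab cg.
have cN : {within `[a, b], continuous (N \o g)}.
  by move=> x; apply: cvg_comp (cg x) _; exact: is_norm_continuous.
have [c _ Nmax] := EVT_max ab cN.
by exists (N (g c)); [exact: is_norm_ge0 | move=> x xab; apply: Nmax; rewrite in_itv].
Qed.

Lemma deriv_bounded g dg (a b L : R) : a <= b ->  deriv_on `[a, b] g dg ->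
  0 <= L -> (forall x, a <= x <= b -> N (dg x) <= L) ->
  exists2 L', 0 <= L' & forall x, a <= x <= b -> N (g x) <= L'.
Proof.
move=> ab gdg L0 dgL; exists (N (g a) + L * (b - a)).
  by apply: addr_ge0; [exact: is_norm_ge0 | rewrite mulr_ge0// subr_ge0].
have lip : forall x y, `[a, b]%classic x -> `[a, b]%classic y ->
    N (g y - g x) <= L * `|y - x|.
  apply: (@deriv_lipschitz `[a, b] g dg) => //; exact: itv_cc_convex.
move=> x xab; have := is_norm_triangle N_norm (g a) (g x) 0; rewrite !subr0.
have : N (g x - g a) <= L * `|x - a| by apply: lip; rewrite /= in_itv/=; lra.
rewrite ger0_norm; last lra.
by move: (N _) (N _) (N _) => p q s; nra.
Qed.

Lemma quadratic_deriv A (a x : R) (l1 l2 : 'rV[R]_d) :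
  deriv_at A (fun y => (y - a) *: l1 + ((y - a) ^+ 2 / 2) *: l2) x
    (l1 + (x - a) *: l2).
Proof.
apply: (@deriv_at_quadratic _ _ _ (N l2)) => y _ _.
have -> : (y - a) *: l1 + ((y - a) ^+ 2 / 2) *: l2 -
    ((x - a) *: l1 + ((x - a) ^+ 2 / 2) *: l2) -
    (y - x) *: (l1 + (x - a) *: l2) = ((y - x) ^+ 2 / 2) *: l2.
  rewrite scalerDr scalerA.
  rewrite [(x - a) *: l1 + _]addrC opprD.
  apply/rowP => j; rewrite !mxE.
  by field.
rewrite is_normZ// normrM normrX mulrC ler_wpM2l//; first exact: is_norm_ge0.
rewrite normfV normr_nat; by have := sqr_ge0 `|y - x|; lra.
Qed.

(** The vector [w] is the one-sided third derivative at [a]. The constant comes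
    from the fourth derivative, which is bounded on the compact interval; with
    only three derivatives the remainder of [ddu] would be [o(x - a)], too weak
    for an error of third order. *)
Lemma class_C4_taylor u du ddu (a b : R) : a < b -> class_C 4 `[a, b] u ->
  deriv_on `[a, b] u du -> deriv_on `[a, b] du ddu ->
  exists w (C : R), 0 <= C /\ forall x, a <= x <= b ->
    [/\ N (du x) <= C, N (ddu x) <= C, N (ddu x - ddu a) <= C * (x - a),
        N (ddu x - ddu a - (x - a) *: w) <= C * (x - a) ^+ 2 &
        N (du x - du a - ((x - a) *: ddu a + ((x - a) ^+ 2 / 2) *: w))
          <= C * (x - a) ^+ 3 /\
        N (u x - u a - ((x - a) *: du a + ((x - a) ^+ 2 / 2) *: ddu a))
          <= C * (x - a) ^+ 3].
Proof.
move=> ab [g1 ug1 [g2 g12 [g3 g23 [g4 g34 g4c]]]] udu dudu.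
have g1E x : `[a, b]%classic x -> g1 x = du x.
  by move=> xab; apply: (deriv_at_unique N_norm ab xab (ug1 x xab)); exact: udu.
have dug2 : deriv_on `[a, b] du g2.
  by move=> x xab; apply: (eq_deriv_at N_norm g1E xab); exact: g12.
have g2E x : `[a, b]%classic x -> g2 x = ddu x.
  by move=> xab; apply: (deriv_at_unique N_norm ab xab (dug2 x xab)); exact: dudu.
have ddu3 : deriv_on `[a, b] ddu g3.
  by move=> x xab; apply: (eq_deriv_at N_norm g2E xab); exact: g23.
have ab' := ltW ab.
have [L4 L40 g4L] := within_continuous_bounded ab' g4c.
have [L3 L30 g3L] := deriv_bounded ab' g34 L40 g4L.
have [L2 L20 g2L] := deriv_bounded ab' ddu3 L30 g3L.
have [L1 L10 g1L] := deriv_bounded ab' dudu L20 g2L.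
have dlin (l1 l2 : 'rV[R]_d) : deriv_on `[a, b]
    (fun y => (y - a) *: l1 + ((y - a) ^+ 2 / 2) *: l2) (fun y => l1 + (y - a) *: l2).
  by move=> x _; exact: quadratic_deriv.
have g3lin x : a <= x <= b -> N (g3 x - g3 a) <= L4 * (x - a).
  move=> xab; have := integrate_estimate (n := 0) g34 (dlin 0 0) L40 _ xab.
  rewrite expr1 !scaler0 !addr0 !subr0; apply=> y yab.
  by rewrite !scaler0 !addr0 subr0 expr0 mulr1; exact: g4L.
have g2lin x : a <= x <= b -> N (ddu x - ddu a) <= L3 * (x - a).
  move=> xab; have := integrate_estimate (n := 0) ddu3 (dlin 0 0) L30 _ xab.
  rewrite expr1 !scaler0 !addr0 !subr0; apply=> y yab.
  by rewrite !scaler0 !addr0 subr0 expr0 mulr1; exact: g3L.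
have g2quad x : a <= x <= b ->
    N (ddu x - ddu a - (x - a) *: g3 a) <= L4 * (x - a) ^+ 2.
  move=> xab; have := integrate_estimate (n := 1) ddu3 (dlin (g3 a) 0) L40 _ xab.
  rewrite !scaler0 !addr0 subrr scale0r !subr0; apply=> y yab.
  by rewrite scaler0 addr0 expr1; exact: g3lin.
have g1quad x : a <= x <= b ->
    N (du x - du a - (x - a) *: ddu a) <= L3 * (x - a) ^+ 2.
  move=> xab; have := integrate_estimate (n := 1) dudu (dlin (ddu a) 0) L30 _ xab.
  rewrite !scaler0 !addr0 subrr scale0r !subr0; apply=> y yab.
  by rewrite scaler0 addr0 expr1; exact: g2lin.
have CM (L L' y : R) : L <= L' -> 0 <= y -> L * y <= L' * y.
  by move=> *; exact: ler_wpM2r.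
exists (g3 a), (L4 + L3 + L2 + L1); split=> [|x xab]; first by rewrite !addr_ge0.
have xa : 0 <= x - a by lra.
have [L3C L4C] : L3 <= L4 + L3 + L2 + L1 /\ L4 <= L4 + L3 + L2 + L1 by lra.
have x2 := exprn_ge0 2 xa; have x3 := exprn_ge0 3 xa.
have a0 : (a - a) ^+ 2 / 2 = 0 :> R by rewrite subrr expr2 !mul0r.
split.
- by apply: le_trans (g1L x xab) _; lra.
- by apply: le_trans (g2L x xab) _; lra.
- by apply: le_trans (g2lin x xab) _; exact: CM.
- by apply: le_trans (g2quad x xab) _; exact: CM.
split.
  have := integrate_estimate (n := 2) dudu (dlin (ddu a) (g3 a)) L40 _ xab.
  rewrite a0 !subrr !scale0r addr0 subr0 => th.
  apply: le_trans (th _) (CM _ _ _ L4C x3) => y yab.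
  by rewrite opprD addrA; exact: g2quad.
have := integrate_estimate (n := 2) udu (dlin (du a) (ddu a)) L30 _ xab.
rewrite a0 !subrr !scale0r addr0 subr0 => th.
apply: le_trans (th _) (CM _ _ _ L3C x3) => y yab.
by rewrite opprD addrA; exact: g1quad.
Qed.

End MeanValue.

(** * Histories and the Lipschitz property of the right-hand side *)

Section HistorySpace.
Context {R : realType} {d : nat} (r : \bar R) (N : 'rV[R]_d -> R).
Hypotheses (N_norm : is_norm N) (r_ge0 : (0 <= r)%E).
Implicit Types (phi psi chi Y Z : R -> 'rV[R]_d).
Local Notation D := (delay_itv r).
Local Notation C1 := (C1_space r N).
Local Notation nm := (max_norm r N).

Lemma delay_itv0 : D 0.
Proof. by split=> //; rewrite leeNl oppe0. Qed.

Lemma hist_in (x : R -> 'rV[R]_d) t th : D th -> hist r x t th = x (t + th).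
Proof. by move=> Dth; rewrite /hist /patch mem_set. Qed.

Lemma delay_itv_ge x y : D x -> x <= y <= 0 -> D y.
Proof.
move=> [rx x0] /andP[xy y0]; split=> //.
by apply: le_trans rx _; rewrite lee_fin.
Qed.

Lemma delay_itv_convex x y : D x -> D y -> `[x, y] `<=` D.
Proof.
move=> Dx [_ y0] z; rewrite /= in_itv/= => /andP[xz zy].
by apply: (delay_itv_ge Dx); lra.
Qed.

Lemma bounded_on_lin A (k : R) phi psi :
  bounded_on N A phi -> bounded_on N A psi -> bounded_on N A (k *: phi + psi).
Proof.
move=> [B phiB] [B' psiB]; exists (`|k| * B + B') => x Ax.
rewrite -[(_ + _) x]/(k *: phi x + psi x).
apply: le_trans (is_normD N_norm _ _) _; rewrite is_normZ// lerD//.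
  by rewrite ler_wpM2l//; exact: phiB.
exact: psiB.
Qed.

Lemma bounded_onB A phi psi :
  bounded_on N A phi -> bounded_on N A psi -> bounded_on N A (phi - psi).
Proof.
by move=> bphi bpsi; rewrite addrC -scaleN1r; exact: bounded_on_lin.
Qed.

(** Boundedness matters here: on an unbounded set the supremum is [0] by
    convention. *)
Lemma max_norm_ub phi th : bounded_on N D phi -> D th -> N (phi th) <= nm phi.
Proof.
move=> [B phiB] Dth; apply: sup_upper_bound; last by exists th.
split; first by exists (N (phi th)), th.
by exists B => _ [x Dx <-]; exact: phiB.
Qed.

Lemma max_norm_le phi (C : R) : (forall th, D th -> N (phi th) <= C) -> nm phi <= C.
Proof.
move=> phiC; apply: ge_sup; first by exists (N (phi 0)), 0 => //; exact: delay_itv0.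
by move=> _ [th Dth <-]; exact: phiC.
Qed.

Lemma max_norm_ge0 phi : bounded_on N D phi -> 0 <= nm phi.
Proof.
by move=> bphi; apply: le_trans (max_norm_ub bphi delay_itv0); exact: is_norm_ge0.
Qed.

Lemma max_normB phi psi : nm (phi - psi) = nm (psi - phi).
Proof.
rewrite /max_norm; congr sup; apply/seteqP.
by split=> _ [th Dth <-]; exists th => //; rewrite -opprB; exact: is_normN.
Qed.

Lemma max_normZ_le (k : R) phi : bounded_on N D phi -> nm (k *: phi) <= `|k| * nm phi.
Proof.
move=> bphi; apply: max_norm_le => th Dth.
rewrite -[(_ *: _) th]/(k *: phi th) is_normZ// ler_wpM2l//; exact: max_norm_ub.
Qed.

Lemma max_norm_triangle psi phi chi : bounded_on N D phi -> bounded_on N D psi ->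
  bounded_on N D chi -> nm (phi - chi) <= nm (phi - psi) + nm (psi - chi).
Proof.
move=> bphi bpsi bchi; apply: max_norm_le => th Dth.
apply: le_trans (is_norm_triangle N_norm (psi th) _ _) _; apply: lerD.
  exact: (max_norm_ub (bounded_onB bphi bpsi) Dth).
exact: (max_norm_ub (bounded_onB bpsi bchi) Dth).
Qed.

Lemma C1_bounded phi : C1 phi -> bounded_on N D phi.
Proof. by move=> [_ [dphi []]]. Qed.

Lemma C1_lin (k : R) phi psi : C1 phi -> C1 psi -> C1 (k *: phi + psi).
Proof.
move=> [phi0 [dphi [phid cdphi bphi bdphi]]] [psi0 [dpsi [psid cdpsi bpsi bdpsi]]].
split=> [th Dth|].
  by rewrite -[LHS]/(k *: phi th + psi th) phi0// psi0// scaler0 addr0.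
exists (k *: dphi + dpsi); split; try exact: bounded_on_lin.
  by move=> x Dx; apply: deriv_at_lin; [exact: phid | exact: psid].
move=> x; apply: cvgD; last exact: cdpsi.
by apply: cvgZr; exact: cdphi.
Qed.

Lemma C1_zero : C1 0.
Proof.
split=> //; exists 0; split.
- move=> x _; apply/(deriv_atP N_norm) => e e0; exists 1 => // y _ _.
  by rewrite subrr scaler0 subrr is_norm0// mulr_ge0// ltW.
- by move=> x; exact: cvg_cst.
- by exists 0 => x _; rewrite is_norm0.
- by exists 0 => x _; rewrite is_norm0.
Qed.

Lemma C1_sub phi psi : C1 phi -> C1 psi -> C1 (phi - psi).
Proof. by move=> C1phi C1psi; rewrite addrC -scaleN1r; exact: C1_lin. Qed.

Section Rhs.
Variable pb : problem r N.

(** The segment between two histories of a ball stays in the ball, hence in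
    the domain, and along it the right-hand side has a derivative bounded by
    the operator norms. The constant is the same for every ball and every
    time. *)
Lemma rhs_lipschitz : rhs_class_C1 pb -> exists2 B : R, 0 <= B &
  forall t phi (e : R), bounded_on N D phi ->
    (forall psi, C1 psi -> nm (psi - phi) < e -> dom pb (t, psi)) ->
    forall psi chi, C1 psi -> C1 chi -> nm (psi - phi) < e -> nm (chi - phi) < e ->
      N (rhs pb t psi - rhs pb t chi) <= B * nm (psi - chi).
Proof.
move=> [Df [_ Df_deriv [B0 Df_bounded] _]]; exists `|B0| => // t phi e bphi ball_dom.
move=> psi chi C1psi C1chi psi_e chi_e.
set om := psi - chi; have C1om : C1 om by exact: C1_sub.
have bom := C1_bounded C1om; have om0 := max_norm_ge0 bom.
pose path s := s *: om + chi.
have C1path s : C1 (path s) by exact: C1_lin.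
have dom_path s : 0 <= s <= 1 -> dom pb (t, path s).
  move=> s01; apply: ball_dom => //.
  have [m [pm cm me]] : exists m, [/\ nm (psi - phi) <= m, nm (chi - phi) <= m & m < e].
    have [pc|cp] := leP (nm (psi - phi)) (nm (chi - phi)); first by exists (nm (chi - phi)).
    by exists (nm (psi - phi)); split => //; exact: ltW.
  apply: le_lt_trans me; apply: max_norm_le => th Dth.
  rewrite -[(_ - _) th]/(s *: (psi th - chi th) + chi th - phi th).
  have -> : s *: (psi th - chi th) + chi th - phi th =
      s *: (psi th - phi th) + (1 - s) *: (chi th - phi th).
    by apply/rowP => j; rewrite !mxE; ring.
  apply: le_trans (is_normD N_norm _ _) _; rewrite !is_normZ//.
  have Np := max_norm_ub (bounded_onB (C1_bounded C1psi) bphi) Dth.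
  have Nc := max_norm_ub (bounded_onB (C1_bounded C1chi) bphi) Dth.
  rewrite !ger0_norm; [|lra..].
  have {}Np : N (psi th - phi th) <= m by exact: le_trans Np pm.
  have {}Nc : N (chi th - phi th) <= m by exact: le_trans Nc cm.
  by move: (N _) (N _) Np Nc => p q; nra.
have path1 : path 1 = psi by rewrite /path scale1r subrK.
have path0 : path 0 = chi by rewrite /path scale0r add0r.
have := @mean_value_local _ _ _ N_norm (fun s => rhs pb t (path s)) 0 1 (`|B0| * nm om) ler01.
rewrite path1 path0 subr0 mulr1; apply=> s s01 e1 e10.
have om1 : 0 < nm om + 1 by lra.
have [dl dl0 near_s] := Df_deriv _ _ (dom_path s s01) _ (divr_gt0 e10 om1).
exists (dl / (nm om + 1)); first exact: divr_gt0.
move=> s' s'01 ss'.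
have path_step : path s' = path s + (s' - s) *: om.
  by rewrite /path addrAC -scalerDl [s + _]addrC subrK.
have C1step : C1 ((s' - s) *: om) by rewrite -[_ *: _]addr0; apply: C1_lin; last exact: C1_zero.
have step_le := max_normZ_le (s' - s) bom.
have step0 := max_norm_ge0 (C1_bounded C1step).
have s_ge0 := normr_ge0 (s' - s).
have step_dl : nm ((s' - s) *: om) < dl.
  by apply: le_lt_trans step_le _; move: ss'; rewrite ltr_pdivlMr//; nra.
have := near_s _ C1step step_dl; rewrite -path_step => /(_ (dom_path _ s'01)) Hs.
have HDf := Df_bounded t _ _ (dom_path s s01) C1step.
have := is_normD N_norm (rhs pb t (path s') - rhs pb t (path s) -
  Df t (path s) ((s' - s) *: om)) (Df t (path s) ((s' - s) *: om)).
rewrite subrK => /le_trans; apply.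
have B0B := ler_norm B0; have B_ge0 := normr_ge0 B0.
have e1E : e1 / (nm om + 1) * (nm om + 1) = e1 by rewrite divfK// gt_eqF.
have e1'0 : 0 < e1 / (nm om + 1) by rewrite divr_gt0.
move: (N _) (N _) Hs HDf => q p Hs HDf.
have {}HDf : q <= `|B0| * (`|s' - s| * nm om).
  apply: le_trans HDf _; apply: le_trans (ler_wpM2r step0 B0B) _.
  by rewrite ler_wpM2l.
have {}Hs : p <= e1 * `|s' - s|.
  apply: le_trans Hs _; apply: le_trans (ler_wpM2l (ltW e1'0) step_le) _.
  rewrite -[in leRHS]e1E; move: (e1 / _) e1'0 => f f0.
  rewrite -mulrA ler_wpM2l ?(ltW f0)// mulrC ler_wpM2r//; lra.
by rewrite mulrDl addrC lerD// -mulrA [nm om * _]mulrC.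
Qed.

(** Existence of a stage value, and its distance to the value at a nearby
    genuine history [Z]. If [Y] is a limit of histories, the Lipschitz property
    turns approximations of [Y] into a Cauchy sequence of values, whose limit
    is [k]. If it is not, the limit condition is void and the value at [Z]
    serves. *)
Lemma rhs_value_near (B t e : R) phi Y Z (rho : R) : 0 <= B ->
  (forall psi, C1 psi -> nm (psi - phi) < e -> dom pb (t, psi)) ->
  (forall psi chi, C1 psi -> C1 chi -> nm (psi - phi) < e -> nm (chi - phi) < e ->
      N (rhs pb t psi - rhs pb t chi) <= B * nm (psi - chi)) ->
  bounded_on N D phi -> bounded_on N D Y -> C1 Z ->
  nm (Y - Z) <= rho -> nm (Z - phi) + rho < e ->
  exists2 k, rhs_value pb t Y k & N (k - rhs pb t Z) <= B * rho.
Proof.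
move=> B0 ball_dom lip bphi bY C1Z YZ Ze.
have bZ := C1_bounded C1Z.
have rho0 : 0 <= rho by apply: le_trans YZ; apply: max_norm_ge0; exact: bounded_onB.
have Zphi : nm (Z - phi) < e by lra.
have Yphi : nm (Y - phi) < e.
  by apply: le_lt_trans Ze; have := max_norm_triangle bY bZ bphi; lra.
pose e1 := e - nm (Y - phi); have e10 : 0 < e1 by rewrite /e1; lra.
have near_Y chi : C1 chi -> nm (chi - Y) < e1 -> nm (chi - phi) < e.
  move=> /C1_bounded bchi; have := max_norm_triangle bchi bY bphi.
  by rewrite /e1; lra.
have domY : exists2 e : R, 0 < e &
    forall chi, C1 chi -> nm (chi - Y) < e -> dom pb (t, chi).
  by exists e1 => // chi C1chi /(near_Y _ C1chi); exact: ball_dom.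
have [dense|] := pselect (forall dl : R, 0 < dl -> exists2 chi, C1 chi & nm (chi - Y) < dl);
    last first.
  move=> /existsNP[dl /not_implyP[dl0 none]]; exists (rhs pb t Z); last first.
    by rewrite subrr is_norm0// mulr_ge0.
  split=> // e' _; exists dl => // chi C1chi chidl; exfalso; apply: none.
  by exists chi.
have inv_gt0 (n : nat) : 0 < Num.min e1 (n.+1%:R^-1) by rewrite lt_min e10 invr_gt0/=.
have /choice[x x_prop] : forall n : nat, exists f : R -> 'rV[R]_d,
    C1 f /\ nm (f - Y) < Num.min e1 (n.+1%:R^-1).
  by move=> n; have [f] := dense _ (inv_gt0 n); exists f.
have C1x n : C1 (x n) by case: (x_prop n).
have xe1 n : nm (x n - Y) < e1 by case: (x_prop n) => _; rewrite lt_min => /andP[].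
have xn n : nm (x n - Y) < n.+1%:R^-1 by case: (x_prop n) => _; rewrite lt_min => /andP[].
have lipY psi chi : C1 psi -> C1 chi -> nm (psi - phi) < e -> nm (chi - phi) < e ->
    N (rhs pb t psi - rhs pb t chi) <= B * (nm (psi - Y) + nm (chi - Y)).
  move=> C1psi C1chi psie chie; apply: le_trans (lip _ _ C1psi C1chi psie chie) _.
  rewrite ler_wpM2l// (max_normB chi) max_norm_triangle//; exact: C1_bounded.
have small (e' : R) : 0 < e' -> exists n0, forall n, (n0 <= n)%N -> B * n.+1%:R^-1 < e'.
  move=> e'0; exists (Num.bound (B / e')) => n n0n.
  rewrite ltr_pdivrMr// -ltr_pdivrMl// mulrC.
  apply: lt_le_trans (archi_boundP _) _; first by rewrite divr_ge0// ltW.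
  by rewrite ler_nat ltnW.
have [|k zk] := @is_norm_complete _ _ _ (fun n => rhs pb t (x n)) N_norm.
  move=> e' e'0; have [n0 n0e] := small (e' / 2) (divr_gt0 e'0 (ltr0Sn R 1)).
  exists n0 => n n0n.
  apply: le_lt_trans (lipY _ _ (C1x n0) (C1x n) (near_Y _ (C1x n0) (xe1 n0))
    (near_Y _ (C1x n) (xe1 n))) _.
  have := n0e _ n0n; have := n0e _ (leqnn n0); have := ltW (xn n); have := ltW (xn n0).
  move=> /(ler_wpM2l B0) + /(ler_wpM2l B0); rewrite mulrDr.
  by move: (B * _) (B * _) (B / _) (B / _) => p q p' q'; lra.
have limit psi (c : R) : (forall n, N (rhs pb t psi - rhs pb t (x n)) <= c + B * n.+1%:R^-1) ->
    N (rhs pb t psi - k) <= c.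
  move=> psic; apply/ler_addgt0Pr => e' e'0; have e'2 : 0 < e' / 2 by lra.
  have [n1 n1e] := small _ e'2; have [n2 n2e] := zk _ e'2.
  have := n1e _ (leq_maxl n1 n2); have := n2e _ (leq_maxr n1 n2).
  have := psic (maxn n1 n2).
  have := is_norm_triangle N_norm (rhs pb t (x (maxn n1 n2))) (rhs pb t psi) k.
  by move: (N _) (N _) (N _) (B / _) => p q p' q'; lra.
have limitY psi : C1 psi -> nm (psi - phi) < e ->
    N (rhs pb t psi - k) <= B * nm (psi - Y).
  move=> C1psi psie; apply: limit => n.
  apply: le_trans (lipY _ _ C1psi (C1x n) psie (near_Y _ (C1x n) (xe1 n))) _.
  by rewrite mulrDr lerD2l ler_wpM2l// ltW.
exists k; last first.
  rewrite is_normB//; apply: le_trans (limitY _ C1Z Zphi) _.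
  by rewrite ler_wpM2l// max_normB.
split=> // e' e'0.
have B1 : 0 < B + 1 by lra.
exists (Num.min e1 (e' / (B + 1))); first by rewrite lt_min e10 divr_gt0.
move=> chi C1chi; rewrite lt_min => /andP[chie1 chie'] _.
apply: le_lt_trans (limitY _ C1chi (near_Y _ C1chi chie1)) _.
have chi0 : 0 <= nm (chi - Y) by apply: max_norm_ge0; apply: bounded_onB => //; exact: C1_bounded.
by move: chie'; rewrite ltr_pdivlMr//; nra.
Qed.

End Rhs.
End HistorySpace.

(** * Solutions and stages near the initial time *)

Definition poly_bound {R : realType} (p : {poly R}) (c : R) : R :=
  `|sval (poly_itv_bound p 0 c)|.

Lemma poly_boundP (R : realType) (p : {poly R}) (c x : R) :
  0 <= x <= c -> `|p.[x]| <= poly_bound p c.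
Proof.
by move=> xc; apply: le_trans (ler_norm _); exact: (svalP (poly_itv_bound p 0 c)).
Qed.

Section Consistency.
Context {R : realType} {d s : nat} (r : \bar R) (N : 'rV[R]_d -> R) (M : fcrkn R s).
Hypotheses (N_norm : is_norm N) (r_ge0 : (0 <= r)%E).
Local Notation D := (delay_itv r).
Local Notation C1 := (C1_space r N).
Local Notation nm := (max_norm r N).

(** Breakpoints of a piecewise smooth function are finitely many on a compact
    interval, so a short enough step never crosses one. *)
Lemma first_piece k (sigma : R) (tbar : \bar R) (u : R -> 'rV[R]_d) :
  (sigma%:E < tbar)%E -> piecewise_C k (solution_itv r sigma tbar) u ->
  exists2 T, 0 < T & class_C k `[sigma, sigma + T] u /\
    `[sigma, sigma + T] `<=` forward_itv sigma tbar.
Proof.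
move=> st pwu.
have [b sb bt] : exists2 b, sigma < b & (b%:E < tbar)%E.
  case: tbar st {pwu} => [t| |] //= st; last by exists (sigma + 1); rewrite ?ltry ?ltrDl.
  by move: st; rewrite lte_fin => st; exists ((sigma + t) / 2); rewrite ?lte_fin; lra.
have sol_s : solution_itv r sigma tbar sigma.
  by split=> //; rewrite -[leRHS]sube0 leeB.
have sol_b : solution_itv r sigma tbar b.
  by split=> //; apply: le_trans (sol_s.1) _; rewrite lee_fin ltW.
have [[|t1 t] [/= path_t last_t pieces]] := pwu _ _ sol_s sol_b (ltW sb).
  by move: sb; rewrite last_t ltxx.
move: path_t => /andP[st1 path_t].
have t1b : t1 <= b.
  rewrite -last_t; elim: t t1 path_t {pieces last_t st1} => //= y t IH x /andP[xy].
  by move=> /IH; apply: le_trans; exact: ltW.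
exists (t1 - sigma); first by rewrite subr_gt0.
rewrite addrC subrK; split; first exact: (pieces 0).
move=> x; rewrite /= in_itv/= => /andP[sx xt1]; split=> //.
by apply: le_lt_trans bt; rewrite lee_fin; exact: le_trans t1b.
Qed.

(** The history is Lipschitz in time at the initial time. An argument that
    crosses [sigma] uses the Lipschitz constant of the initial function before
    [sigma] and that of the solution after it. This also works for [r = +oo],
    where uniform continuity cannot be drawn from compactness. *)
Lemma hist_shift_le (sigma T L1 L2 : R) (u phi : R -> 'rV[R]_d) :
  0 <= L1 -> 0 <= L2 -> hist r u sigma = phi ->
  (forall th th', D th -> D th' -> N (phi th' - phi th) <= L1 * `|th' - th|) ->
  (forall x, 0 <= x <= T -> N (u (sigma + x) - u sigma) <= L2 * x) ->
  forall x, 0 <= x <= T -> nm (hist r u (sigma + x) - phi) <= (L1 + L2) * x.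
Proof.
move=> L10 L20 <- lip_phi lip_u x /andP[x0 xT].
have D0 := delay_itv0 r_ge0.
apply: (max_norm_le r_ge0) => th Dth; rewrite -[(_ - _) th]/(_ th - _ th).
have th0 : th <= 0 by case: Dth.
have := lip_phi (th) (Num.min (x + th) 0) Dth.
have [xth|xth] := leP (x + th) 0.
  have Dx : D (x + th) by apply: (delay_itv_ge Dth); lra.
  move=> /(_ Dx); rewrite !hist_in// addrK ger0_norm// -addrA => /le_trans; apply.
  by rewrite ler_wpM2r//; lra.
move=> /(_ D0); rewrite sub0r normrN ler0_norm// !hist_in// -addrA addr0 => lip_th.
have lip_x : N (u (sigma + (x + th)) - u sigma) <= L2 * (x + th) by apply: lip_u; lra.
have := is_norm_triangle N_norm (u sigma) (u (sigma + (x + th))) (u (sigma + th)).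
by move: lip_th lip_x; move: (N _) (N _) (N _) => p q p'; nra.
Qed.

Lemma stage_fun_ext phi v0 h (K K' : 'I_s -> 'rV[R]_d) (i : 'I_s) :
  (forall j : 'I_s, (j < i)%N -> K j = K' j) ->
  stage_fun M phi v0 h K i = stage_fun M phi v0 h K' i.
Proof.
move=> KK'; apply/funext => x; rewrite /stage_fun; case: ifP => // _.
by congr (_ + _ *: _); apply: eq_bigr => j /KK' ->.
Qed.

(** Recursion over the stages of an explicit method: a property of the [i]-th
    value that reads only the values with smaller index can be met for all
    stages, one after the other. *)
Lemma explicit_ind (T : Type) (t0 : T) (P : 'I_s -> T -> ('I_s -> T) -> Prop) :
  (forall (i : 'I_s) k K K', (forall j : 'I_s, (j < i)%N -> K j = K' j) -> P i k K -> P i k K') ->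
  (forall (i : 'I_s) K, (forall j : 'I_s, (j < i)%N -> P j (K j) K) -> exists k, P i k K) ->
  exists K, forall i, P i (K i) K.
Proof.
move=> Pext Pex.
(* Stages below [n] are filled in; the other entries keep the default [t0]. *)
suff /(_ s)[K KP] : forall n, exists K, forall i : 'I_s, (i < n)%N -> P i (K i) K.
  by exists K => i; exact: KP.
elim=> [|n [K IH]]; first by exists (fun=> t0).
have [sn|ns] := leqP s n.
  by exists K => i _; apply: IH; exact: leq_trans sn.
pose i0 := Ordinal ns; have [k Pk] := Pex i0 K IH.
pose K' (i : 'I_s) := if (i : nat) == n then k else K i.
have KK' (i : 'I_s) : (i < n)%N -> K i = K' i by rewrite /K'; case: ltngtP.
exists K' => i; rewrite ltnS leq_eqVlt => /orP[/eqP in_|i_n].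
  have -> : i = i0 by exact: val_inj.
  by rewrite {1}/K' eqxx; exact: Pext Pk.
rewrite -KK'//; apply: (Pext _ _ K); last exact: IH.
by move=> j ji; apply: KK'; exact: ltn_trans ji _.
Qed.

End Consistency.

(** * Error expansion over one step *)

Definition node_sum {R : realType} {s : nat} (M : fcrkn R s) : R :=
  \sum_(i < s) fc M i.

Definition stage_weight_bound {R : realType} {s : nat} (M : fcrkn R s) : R :=
  \sum_(i < s) \sum_(j < s) poly_bound (fa M i j) (fc M i).

(** The two terms bound, in units of [h ^+ 2], the weighted sum of stage
    values of norm at most [C + 1], and the deviation of the solution from its
    tangent up to time [node_sum M * h]. *)
Definition stage_error_const {R : realType} {s : nat} (M : fcrkn R s) (C T : R) : R :=
  stage_weight_bound M * (C + 1) + C * (T + 1) * node_sum M ^+ 2.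

Section LocalExpansion.
Context {R : realType} {d s : nat} (r : \bar R) (N : 'rV[R]_d -> R) (M : fcrkn R s).
Hypotheses (N_norm : is_norm N) (r_ge0 : (0 <= r)%E).
Local Notation D := (delay_itv r).
Local Notation C1 := (C1_space r N).
Local Notation nm := (max_norm r N).
Variables (pb : problem r N) (sigma : R) (phi u du ddu : R -> 'rV[R]_d) (w : 'rV[R]_d).
Variables (T C L B e : R).
Hypotheses (C_ge0 : 0 <= C) (L_ge0 : 0 <= L) (B_ge0 : 0 <= B).
Hypotheses (T_gt0 : 0 < T) (e_gt0 : 0 < e).
Hypotheses (hist_u : hist r u sigma = phi) (C1phi : C1 phi).
Hypothesis taylor : forall x, 0 <= x <= T ->
  [/\ N (ddu (sigma + x)) <= C,
      N (ddu (sigma + x) - ddu sigma) <= C * x,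
      N (ddu (sigma + x) - ddu sigma - x *: w) <= C * x ^+ 2,
      N (du (sigma + x) - du sigma - (x *: ddu sigma + (x ^+ 2 / 2) *: w))
        <= C * x ^+ 3 &
      N (u (sigma + x) - u sigma - (x *: du sigma + (x ^+ 2 / 2) *: ddu sigma))
        <= C * x ^+ 3].
Hypothesis hist_lip : forall x, 0 <= x <= T -> nm (hist r u (sigma + x) - phi) <= L * x.
Hypothesis solves : forall x, 0 <= x <= T ->
  C1 (hist r u (sigma + x)) /\ ddu (sigma + x) = rhs pb (sigma + x) (hist r u (sigma + x)).
Hypothesis ball_dom : forall t psi, `|t - sigma| < e -> C1 psi -> nm (psi - phi) < e ->
  dom pb (t, psi).
Hypothesis rhs_lip : forall t psi chi, `|t - sigma| < e -> C1 psi -> C1 chi ->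
  nm (psi - phi) < e -> nm (chi - phi) < e ->
  N (rhs pb t psi - rhs pb t chi) <= B * nm (psi - chi).

Local Notation cmax := (node_sum M).
Local Notation A := (stage_weight_bound M).
Local Notation E := (stage_error_const M C T).

Lemma node_le_sum i : fc M i <= cmax.
Proof.
rewrite /node_sum (bigD1 i)//= lerDl; apply: sumr_ge0 => j _; exact: fc_ge0.
Qed.

Lemma node_sum_ge0 : 0 <= cmax.
Proof. by apply: sumr_ge0 => j _; exact: fc_ge0. Qed.

Lemma stage_weight_bound_ge0 : 0 <= A.
Proof. by do 2![apply: sumr_ge0 => ? _]; exact: normr_ge0. Qed.

Lemma stage_error_const_ge0 : 0 <= E.
Proof.
have [C0 T0] := (C_ge0, T_gt0); have C1_ge0 : 0 <= C + 1 by lra.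
have T1_ge0 : 0 <= T + 1 by lra.
by apply: addr_ge0; rewrite mulr_ge0 ?stage_weight_bound_ge0 ?exprn_ge0 ?node_sum_ge0// mulr_ge0.
Qed.

(** Before [sigma] the stage function and the solution coincide. After it both
    start with the same value and slope, so their difference is of order
    [h ^+ 2] as soon as the stage values are bounded. This is enough, because
    the stage error enters [deta] with a further factor [h]. *)
Lemma stage_close K (i : 'I_s) (h : R) : 0 < h -> fc M i * h <= T ->
  (forall j : 'I_s, (j < i)%N -> N (K j) <= C + 1) ->
  forall th, D th ->
  N (hist r (stage_fun M phi (du sigma) h K i) (fc M i * h) th -
     hist r u (sigma + fc M i * h) th) <= E * h ^+ 2.
Proof.
have [C0 T0] := (C_ge0, T_gt0); move=> h0 chT KC th Dth; rewrite !hist_in// -addrA.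
have th0 : th <= 0 by case: Dth.
set x := fc M i * h + th; have x_le : x <= fc M i * h by rewrite /x; lra.
have Eh : 0 <= E * h ^+ 2 by rewrite mulr_ge0 ?stage_error_const_ge0// exprn_ge0// ltW.
have ci0 := fc_ge0 M i.
rewrite /stage_fun; have [x0|x0] := leP x 0.
  have Dx : D x by apply: (delay_itv_ge Dth); rewrite x0 /x lerDr mulr_ge0// ltW.
  by rewrite -hist_u hist_in// subrr is_norm0.
have -> : phi 0 = u sigma by rewrite -hist_u hist_in ?addr0//; exact: delay_itv0.
set S := \sum_(j < s | _) _.
have NS : N S <= A * (C + 1).
  rewrite /stage_weight_bound mulr_suml (bigD1 i)//= -[leLHS]addr0 lerD//; last first.
    apply: sumr_ge0 => j _; rewrite mulr_ge0//; last lra.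
    by apply: sumr_ge0 => l _; exact: normr_ge0.
  apply: le_trans (is_norm_sum N_norm _ _) _; rewrite mulr_suml big_mkcond.
  apply: ler_sum => j _; case: ifP => ji; last first.
    by rewrite mulr_ge0//; [exact: normr_ge0 | lra].
  rewrite is_normZ// ler_pM//; [exact: is_norm_ge0| |exact: KC].
  apply: poly_boundP; rewrite ler_pdivrMr// x_le andbT.
  by rewrite divr_ge0// ltW.
have /taylor[ddu_le _ _ _ u_taylor] : 0 <= x <= T by lra.
have ddu0 : N (ddu sigma) <= C.
  have /taylor[] : 0 <= (0 : R) <= T by lra.
  by rewrite addr0.
set rem := u (sigma + x) - _ - _ in u_taylor.
have -> : u sigma + x *: du sigma + h ^+ 2 *: S - u (sigma + x) =
    (h ^+ 2 *: S - rem) - (x ^+ 2 / 2) *: ddu sigma.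
  by rewrite /rem; apply/rowP => j; rewrite !mxE; ring.
apply: le_trans (is_normD N_norm _ _) _; rewrite is_normN// is_normZ//.
have := is_normD N_norm (h ^+ 2 *: S) (- rem); rewrite is_normN// is_normZ//.
have h2 : 0 <= h ^+ 2 by rewrite exprn_ge0// ltW.
have x2 : 0 <= x ^+ 2 by rewrite exprn_ge0// ltW.
rewrite !ger0_norm//; last by rewrite mulr_ge0.
have x2_le : x ^+ 2 <= cmax ^+ 2 * h ^+ 2.
  rewrite -exprMn lerXn2r// ?nnegrE ?(ltW x0)// ?mulr_ge0 ?node_sum_ge0 ?(ltW h0)//.
  by apply: le_trans x_le _; rewrite ler_wpM2r ?node_le_sum// ltW.
have rem_le : N rem <= C * T * x ^+ 2.
  apply: le_trans u_taylor _; rewrite exprS mulrA ler_wpM2r// ler_wpM2l//; lra.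
have hS : h ^+ 2 * N S <= h ^+ 2 * (A * (C + 1)) by rewrite ler_wpM2l.
have xddu : x ^+ 2 / 2 * N (ddu sigma) <= x ^+ 2 / 2 * C by rewrite ler_wpM2l// mulr_ge0.
have CT : C * (T + 1) * x ^+ 2 <= C * (T + 1) * (cmax ^+ 2 * h ^+ 2).
  by rewrite ler_wpM2l// mulr_ge0//; lra.
have Cx : 0 <= C * x ^+ 2 by rewrite mulr_ge0.
rewrite /stage_error_const; move: hS xddu CT Cx rem_le.
move: (N _) (N _) (N _) (N _) => p q p' q'.
move: (x ^+ 2) (h ^+ 2) (cmax ^+ 2) => xx hh cc; lra.
Qed.

(** The stages exist for all small [h], and their values differ from the second
    derivative of the solution by [O(h ^+ 2)]. The bound [C + 1] on the previous
    values, which [stage_close] asks for, is reproduced at every stage thanks to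
    [B * E * h <= 1]. *)
Lemma stages_close (h : R) : 0 < h -> h <= T -> cmax * h <= T -> cmax * h < e ->
  (L * cmax + E) * h < e -> B * E * h <= 1 -> h <= 1 ->
  exists2 K, stages M pb sigma phi (du sigma) h K &
    forall i, N (K i - ddu (sigma + fc M i * h)) <= B * (E * h ^+ 2).
Proof.
have [C0 T0] := (C_ge0, T_gt0); move=> h0 hT chT che Lche BEh h1.
have E0 := stage_error_const_ge0.
have hh : h ^+ 2 <= h by rewrite expr2 ger_pMl.
have ch i : 0 <= fc M i * h <= cmax * h.
  by rewrite mulr_ge0 ?fc_ge0 ?(ltW h0)//= ler_wpM2r ?node_le_sum// ltW.
have chT' i : 0 <= fc M i * h <= T by have := ch i; lra.
have BE_le : B * (E * h ^+ 2) <= 1.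
  apply: le_trans BEh; rewrite -mulrA ler_wpM2l// ler_wpM2l//.
have [|K|K KP] := @explicit_ind s 'rV[R]_d 0 (fun i k K =>
    rhs_value pb (sigma + fc M i * h)
      (hist r (stage_fun M phi (du sigma) h K i) (fc M i * h)) k /\
    N (k - ddu (sigma + fc M i * h)) <= B * (E * h ^+ 2)).
- by move=> i k K K' /(stage_fun_ext M phi (du sigma) h) ->.
- move=> K' IH.
  have KC (j : 'I_s) : (j < K)%N -> N (K' j) <= C + 1.
    move=> /IH[_ Kj]; have /taylor[dduC _ _ _ _] := chT' j.
    have := is_norm_triangle N_norm (ddu (sigma + fc M j * h)) (K' j) 0.
    by rewrite !subr0; move: Kj dduC; move: (N _) (N _) (N _) => p q p'; lra.
  have [C1u duE] := solves (chT' K).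
  have close := stage_close h0 (proj2 (andP (chT' K))) KC.
  have lipu := hist_lip (chT' K).
  have te : `|sigma + fc M K * h - sigma| < e.
    by rewrite addrAC subrr add0r ger0_norm; have := ch K; lra.
  set Y := hist r (stage_fun _ _ _ _ _ _) _ in close *.
  set Z := hist r u _ in close C1u duE lipu.
  have bYZ : bounded_on N D (Y - Z) by exists (E * h ^+ 2).
  have bY : bounded_on N D Y.
    rewrite -[Y](subrK Z) -[Y - Z]scale1r; apply: bounded_on_lin => //.
    exact: C1_bounded.
  have [||k kY kZ] := @rhs_value_near _ _ _ _ N_norm r_ge0 pb B (sigma + fc M K * h) e
      phi Y Z (E * h ^+ 2) B_ge0 (fun psi => ball_dom te)
      (fun psi chi => rhs_lip te) (C1_bounded C1phi) bY C1u.
  + exact: (max_norm_le r_ge0).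
  + apply: le_lt_trans Lche; rewrite [leRHS]mulrDl lerD//; last by rewrite ler_wpM2l.
    by apply: le_trans lipu _; rewrite -mulrA ler_wpM2l//; case/andP: (ch K).
  by exists k; split=> //; rewrite duE.
exists K => i; first by case: (KP i).
by case: (KP i).
Qed.

Lemma weighted_sum_le (p : 'I_s -> {poly R}) (v : 'I_s -> 'rV[R]_d) (al m : R) :
  0 <= al <= 1 -> 0 <= m -> (forall i, N (v i) <= m) ->
  N (\sum_(i < s) (p i).[al] *: v i) <= (\sum_(i < s) poly_bound (p i) 1) * m.
Proof.
move=> al01 m0 vm; apply: le_trans (is_norm_sum N_norm _ _) _.
rewrite mulr_suml; apply: ler_sum => i _; rewrite is_normZ// ler_pM//.
  exact: is_norm_ge0.
exact: poly_boundP.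
Qed.

Section Error.
Variables (K : 'I_s -> 'rV[R]_d) (h rho al : R).
Hypotheses (h_gt0 : 0 < h) (h_le1 : h <= 1) (h_leT : h <= T) (rho_ge0 : 0 <= rho).
Hypothesis ch_leT : cmax * h <= T.
Hypothesis K_close : forall i, N (K i - ddu (sigma + fc M i * h)) <= rho * h ^+ 2.
Hypothesis al01 : 0 <= al <= 1.

Lemma node_in i : 0 <= fc M i * h <= T.
Proof.
have h0 := ltW h_gt0; rewrite mulr_ge0 ?fc_ge0//=.
by apply: le_trans ch_leT; rewrite ler_wpM2r// node_le_sum.
Qed.

Lemma abscissa_in : 0 <= al * h <= T.
Proof.
have h0 := ltW h_gt0; have /andP[al0 al1] := al01; rewrite mulr_ge0//=.
by apply: le_trans h_leT; rewrite ler_piMl.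
Qed.

Lemma abscissa_cube_le : C * (al * h) ^+ 3 <= C * h ^+ 3.
Proof.
have h0 := ltW h_gt0; have /andP[al0 al1] := al01.
by rewrite ler_wpM2l// lerXn2r ?nnegrE ?mulr_ge0// ler_piMl.
Qed.

(** The weights [b] integrate the constant [ddu sigma] exactly, and the stage
    values differ from it by [O(h)]; the factor [h ^+ 2] in front of the sum
    makes this [O(h ^+ 3)]. *)
Lemma eta_error :
  \sum_(i < s) (fb M i).[al] = al ^+ 2 / 2 ->
  N (eta M phi (du sigma) h K al - u (sigma + al * h)) <=
    ((\sum_(i < s) poly_bound (fb M i) 1) * (rho + C * cmax) + C) * h ^+ 3.
Proof.
move=> sum_b; have [h0 C0] := (ltW h_gt0, C_ge0); have /taylor[_ _ _ _ u_taylor] := abscissa_in.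
rewrite /eta -hist_u hist_in ?addr0; last exact: delay_itv0.
set S := \sum_(i < s) _; set rem := u _ - _ - _ in u_taylor.
pose S' := \sum_(i < s) (fb M i).[al] *: (K i - ddu sigma).
have SE : S = S' + (al ^+ 2 / 2) *: ddu sigma.
  rewrite -sum_b scaler_suml -big_split/=; apply: eq_bigr => i _.
  by rewrite scalerBr subrK.
have -> : u sigma + (al * h) *: du sigma + h ^+ 2 *: S - u (sigma + al * h) =
    h ^+ 2 *: S' - rem.
  by rewrite SE /rem; apply/rowP => j; rewrite !mxE; ring.
apply: le_trans (is_normD N_norm _ _) _; rewrite is_normN// is_normZ//.
rewrite ger0_norm ?exprn_ge0// mulrDl; apply: lerD; last first.
  by apply: le_trans u_taylor _; exact: abscissa_cube_le.
have -> : h ^+ 3 = h ^+ 2 * h by rewrite exprSr.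
rewrite [leRHS]mulrCA ler_wpM2l ?exprn_ge0// -mulrA.
apply: weighted_sum_le => // [|i].
  by rewrite mulr_ge0// addr_ge0// mulr_ge0// node_sum_ge0.
have /taylor[_ ddu_lip _ _ _] := node_in i.
apply: le_trans (is_norm_triangle N_norm (ddu (sigma + fc M i * h)) _ _) _.
rewrite mulrDl lerD//.
  by apply: le_trans (K_close i) _; rewrite expr2 ler_wpM2l// ler_piMl.
apply: le_trans ddu_lip _; rewrite -mulrA ler_wpM2l// ler_wpM2r//; exact: node_le_sum.
Qed.

(** The stage values agree with [ddu sigma + (fc M i * h) *: w] up to
    [O(h ^+ 2)]. The weights [b'] integrate the constant part exactly by the
    first condition and the linear part by the second one, which is where the
    order condition enters. *)
Lemma deta_error :
  \sum_(i < s) (fdb M i).[al] = al ->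
  \sum_(i < s) (fdb M i).[al] * fc M i = al ^+ 2 / 2 ->
  N (deta M (du sigma) h K al - du (sigma + al * h)) <=
    ((\sum_(i < s) poly_bound (fdb M i) 1) * (rho + C * cmax ^+ 2) + C) * h ^+ 3.
Proof.
move=> sum_b sum_bc; have [h0 C0] := (ltW h_gt0, C_ge0).
have /taylor[_ _ _ du_taylor _] := abscissa_in.
rewrite /deta.
set S := \sum_(i < s) _; set rem := du _ - _ - _ in du_taylor.
pose S' := \sum_(i < s) (fdb M i).[al] *: (K i - ddu sigma - (fc M i * h) *: w).
have SE : S = S' + (al *: ddu sigma + (al ^+ 2 / 2 * h) *: w).
  rewrite -{1}sum_b -sum_bc mulr_suml !scaler_suml -!big_split/=.
  by apply: eq_bigr => i _; apply/rowP => j; rewrite !mxE; ring.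
have -> : du sigma + h *: S - du (sigma + al * h) = h *: S' - rem.
  by rewrite SE /rem; apply/rowP => j; rewrite !mxE; ring.
apply: le_trans (is_normD N_norm _ _) _; rewrite is_normN// is_normZ//.
rewrite ger0_norm// mulrDl; apply: lerD; last first.
  by apply: le_trans du_taylor _; exact: abscissa_cube_le.
have -> : h ^+ 3 = h * h ^+ 2 by rewrite exprS.
rewrite [leRHS]mulrCA ler_wpM2l// -mulrA.
have h2 := exprn_ge0 2 h0; have c2 := exprn_ge0 2 node_sum_ge0.
apply: weighted_sum_le => // [|i].
  by rewrite mulr_ge0// addr_ge0// mulr_ge0.
have /taylor[_ _ ddu_quad _ _] := node_in i.
rewrite -addrA -opprD.
apply: le_trans (is_norm_triangle N_norm (ddu (sigma + fc M i * h)) _ _) _.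
rewrite mulrDl lerD// opprD addrA.
apply: le_trans ddu_quad _; rewrite -mulrA ler_wpM2l// exprMn ler_wpM2r//.
by rewrite lerXn2r ?nnegrE ?fc_ge0 ?node_sum_ge0// node_le_sum.
Qed.

End Error.
End LocalExpansion.

(** * The order conditions are sufficient *)

Section Sufficiency.
Context {R : realType} {d s : nat} (r : \bar R) (N : 'rV[R]_d -> R) (M : fcrkn R s).
Hypotheses (N_norm : is_norm N) (r_ge0 : (0 <= r)%E).

(** Smoothness level 4 makes the second derivative of the solution affine up to
    a quadratic remainder, see [class_C4_taylor]. *)
Lemma order_two_sufficient (I : set R)
    (S : problem r N -> R -> \bar R -> (R -> 'rV[R]_d) -> Prop) :
  (forall pb sigma tbar u, S pb sigma tbar u -> rhs_class_C1 pb) ->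
  (forall al, I al -> [/\ 0 <= al <= 1,
     \sum_(i < s) (fdb M i).[al] = al,
     \sum_(i < s) (fb M i).[al] = al ^+ 2 / 2 &
     \sum_(i < s) (fdb M i).[al] * fc M i = al ^+ 2 / 2]) ->
  has_order M S 2 I.
Proof.
move=> S_C1 I_order.
exists 4 => pb sigma phi v0 tbar u du [dom_phi _ st hist_u sol] _ /S_C1 rhs_C1 pwu.
have [ddu [udu dudu du_sigma u_eq]] := sol.
have C1phi := dom_C1 dom_phi; have bphi := C1_bounded C1phi.
have [T T0 [C4u subT]] := first_piece r_ge0 st pwu.
have inT x : 0 <= x <= T -> `[sigma, sigma + T]%classic (sigma + x).
  by rewrite /= in_itv/=; lra.
have uduT : deriv_on `[sigma, sigma + T] u du.
  by move=> x xT; apply: (deriv_at_sub N_norm subT); apply: udu; exact: subT.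
have duduT : deriv_on `[sigma, sigma + T] du ddu.
  by move=> x xT; apply: (deriv_at_sub N_norm subT); apply: dudu; exact: subT.
have sT : sigma < sigma + T by rewrite ltrDl.
have [w [C [C0 taylor]]] := class_C4_taylor N_norm sT C4u uduT duduT.
have duC x : sigma <= x <= sigma + T -> N (du x) <= C by move=> /taylor[].
have {}taylor x : 0 <= x <= T ->
  [/\ N (ddu (sigma + x)) <= C,
      N (ddu (sigma + x) - ddu sigma) <= C * x,
      N (ddu (sigma + x) - ddu sigma - x *: w) <= C * x ^+ 2,
      N (du (sigma + x) - du sigma - (x *: ddu sigma + (x ^+ 2 / 2) *: w))
        <= C * x ^+ 3 &
      N (u (sigma + x) - u sigma - (x *: du sigma + (x ^+ 2 / 2) *: ddu sigma))
        <= C * x ^+ 3].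
  move=> xT; have /taylor : sigma <= sigma + x <= sigma + T by lra.
  by rewrite addrAC subrr add0r => -[? ? ? ? []].
have [_ [dphi [phid _ _ [B1 dphiB1]]]] := C1phi.
have lip_phi : forall th th', delay_itv r th -> delay_itv r th' ->
    N (phi th' - phi th) <= `|B1| * `|th' - th|.
  apply: (deriv_lipschitz N_norm _ phid); first exact: delay_itv_convex.
  by move=> th Dth; apply: le_trans (dphiB1 th Dth) (ler_norm _).
have lip_u x : 0 <= x <= T -> N (u (sigma + x) - u sigma) <= C * x.
  move=> xT; have : N (u (sigma + x) - u sigma) <= C * `|sigma + x - sigma|.
    apply: (deriv_lipschitz N_norm _ uduT).
    - exact: itv_cc_convex.
    - by move=> y yT; apply: (@duC y); move: yT; rewrite /= in_itv.
    - by rewrite -[X in _ X](addr0 sigma); apply: inT; lra.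
    - exact: inT.
  by rewrite addrAC subrr add0r ger0_norm//; lra.
have hist_lip := hist_shift_le N_norm r_ge0 (normr_ge0 B1) C0 hist_u lip_phi lip_u.
have L0 : 0 <= `|B1| + C by rewrite addr_ge0.
have solves x : 0 <= x <= T -> C1_space r N (hist r u (sigma + x)) /\
    ddu (sigma + x) = rhs pb (sigma + x) (hist r u (sigma + x)).
  by move=> /inT/subT/u_eq[/dom_C1 ? ?].
have [e e0 ball_dom] := dom_open dom_phi.
have [B B0 rhs_lip] := rhs_lipschitz N_norm r_ge0 rhs_C1.
have {}rhs_lip t psi chi : `|t - sigma| < e -> C1_space r N psi -> C1_space r N chi ->
    max_norm r N (psi - phi) < e -> max_norm r N (chi - phi) < e ->
    N (rhs pb t psi - rhs pb t chi) <= B * max_norm r N (psi - chi).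
  by move=> te; apply: rhs_lip => // chi' C1chi'; exact: ball_dom.
set cmax := node_sum M; have cmax0 : 0 <= cmax := node_sum_ge0 M.
set E := stage_error_const M C T.
have E0 : 0 <= E := stage_error_const_ge0 M C0 T0.
set L := `|B1| + C in hist_lip L0.
(* [q] dominates every coefficient of [h] that the stages have to control, so
   [h * q < m] yields all smallness conditions at once. *)
pose q := 1 + cmax + L * cmax + E + B * E.
have q0 : 0 < q by rewrite /q ltr_wpDr ?mulr_ge0// ltr_wpDr// ltr_wpDr ?mulr_ge0// ltr_wpDr.
pose m := Num.min (Num.min T e) 1.
have /andP[/andP[mT me] m1] : (m <= T) && (m <= e) && (m <= 1) by rewrite -!le_min.
have m0 : 0 < m by rewrite !lt_min T0 e0/=.
pose Cb := (\sum_(i < s) poly_bound (fb M i) 1) * (B * E + C * cmax) + C + 1.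
pose Cd := (\sum_(i < s) poly_bound (fdb M i) 1) * (B * E + C * cmax ^+ 2) + C + 1.
have BE0 : 0 <= B * E by rewrite mulr_ge0.
have sum_ge0 (p : 'I_s -> {poly R}) : 0 <= \sum_(i < s) poly_bound (p i) 1.
  by apply: sumr_ge0 => i _; exact: normr_ge0.
exists (m / q), Cb, Cd; split.
- exact: divr_gt0.
- by rewrite ltr_wpDl// addr_ge0// mulr_ge0// addr_ge0// mulr_ge0.
- by rewrite ltr_wpDl// addr_ge0// mulr_ge0// addr_ge0// mulr_ge0// exprn_ge0.
move=> h /andP[h0]; rewrite ltr_pdivlMr// => hq.
have [h_le cmax_le Lc_le BE_le] : [/\ h < m, cmax * h < m, (L * cmax + E) * h < m & B * E * h < m].
  have small (z : R) : z <= q -> z * h < m.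
    by move=> zq; apply: le_lt_trans hq; rewrite mulrC ler_wpM2l// ltW.
  have Lc0 : 0 <= L * cmax by rewrite mulr_ge0.
  rewrite -{1}[h]mul1r.
  by split; apply: small; rewrite /q; move: Lc0 cmax0 E0 BE0;
    move: (L * cmax) (B * E) => *; lra.
have [K K_stages K_close] : exists2 K, stages M pb sigma phi (du sigma) h K &
    forall i, N (K i - ddu (sigma + fc M i * h)) <= B * (E * h ^+ 2).
  have [hT cT] : h <= T /\ cmax * h <= T.
    by split; apply: le_trans mT; exact: ltW.
  have [ce Lce] : cmax * h < e /\ (L * cmax + E) * h < e.
    by split; exact: lt_le_trans me.
  have [BE1 h1] : B * E * h <= 1 /\ h <= 1.
    by split; apply: le_trans m1; exact: ltW.
  by apply: (stages_close (e := e) N_norm r_ge0 C0 L0 B0 T0 hist_u C1phi taylor hist_lip solves).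
exists K; first by rewrite -du_sigma.
move=> al /I_order[al01 sum_db sum_b sum_dbc].
have {}K_close i : N (K i - ddu (sigma + fc M i * h)) <= B * E * h ^+ 2.
  by rewrite -mulrA.
have h1 : h <= 1 by apply: le_trans m1; exact: ltW.
have [hT chT] : h <= T /\ cmax * h <= T by split; apply: le_trans mT; exact: ltW.
have h3 : 0 <= h ^+ 3 by rewrite exprn_ge0// ltW.
rewrite -du_sigma; split.
  have := eta_error (rho := B * E) N_norm r_ge0 C0 hist_u taylor h0 h1 hT BE0 chT K_close al01 sum_b.
  by move=> /le_trans; apply; rewrite ler_wpM2r// lerDl.
have := deta_error (rho := B * E) N_norm C0 taylor h0 hT BE0 chT K_close al01 sum_db sum_dbc.
by move=> /le_trans; apply; rewrite ler_wpM2r// lerDl.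
Qed.

End Sufficiency.

(** * Derivatives of scalar multiples of a vector and smoothing of the ramp *)

Section ScalarCalculus.
Context {R : realType} {d : nat} (N : 'rV[R]_d -> R).
Hypothesis N_norm : is_norm N.
Implicit Types (A : set R) (f df : R -> R) (v : 'rV[R]_d).

Lemma deriv_at_scalar A f (x l : R) v : is_derive x 1 f l ->
  deriv_at A (fun y => f y *: v) x (l *: v).
Proof.
move=> [fx fl]; apply/(deriv_atP N_norm) => e e0.
have Nv0 : 0 < N v + 1 by have := is_norm_ge0 N_norm v; lra.
have eN : 0 < e / (N v + 1) by rewrite divr_gt0.
move: fx; rewrite /derivable => /(@cvgrPdist_le _ _ _ (0:R)^').
rewrite -/('D_1 f x) fl => /(_ _ eN).
rewrite near_withinE => /nbhs_ballP[dl /= dl0 near_x].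
exists dl => // y _ yx; have [->|y_neq_x] := eqVneq y x.
  by rewrite !subrr scale0r subr0 is_norm0// normr0 mulr0.
have yx0 : y - x != 0 by rewrite subr_eq0.
have : ball 0 dl (y - x) by rewrite /ball/= sub0r normrN.
move=> /near_x /(_ yx0); rewrite -[(y - x) *: 1]/((y - x) * 1) mulr1 subrK.
rewrite -[_^-1 *: _]/(_^-1 * (f y - f x)) => fyx.
rewrite scalerA -!scalerBl is_normZ//.
have -> : f y - f x - (y - x) * l = - ((y - x) * (l - (y - x)^-1 * (f y - f x))).
  by field.
rewrite normrN normrM -mulrA [leRHS]mulrC ler_wpM2l// mulrC.
apply: le_trans (ler_wpM2l (is_norm_ge0 N_norm v) fyx) _.
rewrite mulrA ler_pdivrMr// mulrC ler_wpM2l ?ltW//; lra.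
Qed.

Lemma within_continuous_eq A (g1 g2 : R -> 'rV[R]_d) :
  (forall x, A x -> g1 x = g2 x) -> {within A, continuous g1} ->
  {within A, continuous g2}.
Proof. by move=> g12; apply: subspace_eq_continuous => x; rewrite inE; exact: g12. Qed.

Lemma scalar_continuous f v : continuous f -> continuous (fun x => f x *: v).
Proof. by move=> cf x; apply: cvgZl; exact: cf. Qed.

Lemma class_C_poly k A (p : {poly R}) v (g : R -> 'rV[R]_d) :
  (forall x, A x -> g x = p.[x] *: v) -> class_C k A g.
Proof.
elim: k => [|k IH] in p g * => gp /=.
  apply: (@within_continuous_eq _ (fun x => p.[x] *: v)) => [x /gp//|].
  apply: continuous_subspaceT; apply: scalar_continuous; exact: continuous_horner.
exists (fun x => p^`().[x] *: v); last by apply: IH.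
move=> x Ax; apply: (@eq_deriv_at _ _ N N_norm A (fun y => p.[y] *: v)) => //.
  by move=> y /gp.
exact: deriv_at_scalar.
Qed.

Lemma poly_lipschitz (p : {poly R}) (c : R) v :
  exists2 L, 0 <= L & forall x y, 0 <= x <= c -> 0 <= y <= c ->
    N (p.[y] *: v - p.[x] *: v) <= L * `|y - x|.
Proof.
exists (poly_bound p^`() c * N v) => [|x y xc yc].
  by rewrite mulr_ge0 ?is_norm_ge0//; exact: normr_ge0.
apply: (@deriv_lipschitz _ _ N N_norm `[0, c] (fun z => p.[z] *: v) (fun z => p^`().[z] *: v)).
- exact: itv_cc_convex.
- by move=> z _; exact: deriv_at_scalar.
- move=> z; rewrite /= in_itv/= => zc; rewrite is_normZ// ler_wpM2r ?is_norm_ge0//.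
  exact: poly_boundP.
- by rewrite /= in_itv.
- by rewrite /= in_itv.
Qed.

End ScalarCalculus.

Section SmoothRamp.
Context {R : realType}.

(** A smooth function whose distance to [Num.max x 0] is at most [eps]: half of
    the sum of [x] and a regularization of its absolute value. *)
Definition smooth_ramp (eps x : R) : R := (Num.sqrt (x ^+ 2 + eps ^+ 2) + x) / 2.

Lemma smooth_ramp_close (eps x : R) : 0 < eps ->
  Num.max x 0 <= smooth_ramp eps x <= Num.max x 0 + eps.
Proof.
move=> eps0; rewrite /smooth_ramp.
have s_ge : `|x| <= Num.sqrt (x ^+ 2 + eps ^+ 2).
  by rewrite -sqrtr_sqr ler_wsqrtr// lerDl sqr_ge0.
have s_le : Num.sqrt (x ^+ 2 + eps ^+ 2) <= `|x| + eps.
  rewrite -[leRHS]ger0_norm ?addr_ge0 ?(ltW eps0)// -sqrtr_sqr ler_wsqrtr//.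
  rewrite sqrrD real_normK ?num_real// -addrA lerD2l lerDr mulrn_wge0//.
  by rewrite mulr_ge0// ltW.
have [x0|x0] := leP x 0.
  by move: s_ge s_le; rewrite ler0_norm//; lra.
by move: s_ge s_le; rewrite gtr0_norm//; lra.
Qed.

Definition smooth_ramp_deriv (eps x : R) : R := (x / Num.sqrt (x ^+ 2 + eps ^+ 2) + 1) / 2.

Lemma smooth_ramp_is_derive (eps x : R) : 0 < eps ->
  is_derive x 1 (smooth_ramp eps) (smooth_ramp_deriv eps x).
Proof.
move=> eps0; have pos : 0 < x ^+ 2 + eps ^+ 2.
  by rewrite ltr_wpDl ?sqr_ge0// exprn_gt0.
have ds := is_derive1_sqrt pos.
have dq : is_derive x 1 (fun y : R => y ^+ 2 + eps ^+ 2) (2 * x).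
  have -> : (fun y : R => y ^+ 2 + eps ^+ 2) = horner ('X^2 + (eps ^+ 2)%:P).
    by apply/funext => y; rewrite hornerD hornerXn hornerC.
  suff -> : 2 * x = ('X^2 + (eps ^+ 2)%:P)^`().[x] by exact: is_derive_poly.
  by rewrite derivD derivC derivXn addr0 hornerMn hornerXn expr1 mulr_natl.
have dc : is_derive x 1 (fun y : R => Num.sqrt (y ^+ 2 + eps ^+ 2))
    ((2 * Num.sqrt (x ^+ 2 + eps ^+ 2))^-1 * (2 * x)).
  exact: (@is_derive1_comp _ Num.sqrt (fun y : R => y ^+ 2 + eps ^+ 2) x _ _ ds dq).
rewrite /smooth_ramp /smooth_ramp_deriv.
have -> : (fun x : R => (Num.sqrt (x ^+ 2 + eps ^+ 2) + x) / 2) =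
    2^-1 *: ((fun y : R => Num.sqrt (y ^+ 2 + eps ^+ 2)) + id).
  by apply/funext => y; rewrite mulrC.
apply: is_derive_eq; rewrite -[_ *: _]/(_ * _) mulrC; congr (_ * _).
congr (_ + _); rewrite invfM mulrC; field.
by rewrite gt_eqF// sqrtr_gt0.
Qed.

Lemma smooth_ramp_deriv_continuous (eps : R) : 0 < eps -> continuous (smooth_ramp_deriv eps).
Proof.
move=> eps0 x; rewrite /smooth_ramp_deriv.
apply: cvgMl; apply: cvgD; last exact: cvg_cst.
apply: cvgM; first exact: cvg_id.
apply: cvgV; first by rewrite gt_eqF// sqrtr_gt0 ltr_wpDl ?sqr_ge0// exprn_gt0.
apply: (continuous_comp (f := fun y : R => y ^+ 2 + eps ^+ 2)); last exact: sqrt_continuous.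
by apply: cvgD; [exact: exprn_continuous | exact: cvg_cst].
Qed.

Lemma smooth_ramp_deriv_le1 (eps x : R) : 0 < eps -> `|smooth_ramp_deriv eps x| <= 1.
Proof.
move=> eps0; rewrite /smooth_ramp_deriv.
have s0 : 0 < Num.sqrt (x ^+ 2 + eps ^+ 2).
  by rewrite sqrtr_gt0 ltr_wpDl ?sqr_ge0// exprn_gt0.
have : `|x / Num.sqrt (x ^+ 2 + eps ^+ 2)| <= 1.
  rewrite normrM normfV (gtr0_norm s0) ler_pdivrMr// mul1r.
  by rewrite -sqrtr_sqr ler_wsqrtr// lerDl sqr_ge0.
by rewrite !ler_norml; lra.
Qed.

End SmoothRamp.

(** * Functions of the ramp as histories *)

Section Ramp.
Context {R : realType} {d : nat} (N : 'rV[R]_d -> R).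
Hypothesis N_norm : is_norm N.

Definition ramp (x : R) : R := Num.max x 0.

Lemma ramp_cube_deriv (A : set R) (x : R) (v : 'rV[R]_d) :
  deriv_at A (fun y => (ramp y ^+ 3 / 6) *: v) x ((ramp x ^+ 2 / 2) *: v).
Proof.
apply: (deriv_at_quadratic N_norm (C := (3 * `|x| + 1) * N v)) => y _ yx.
rewrite scalerA -2![_ *: v - _ *: v]scalerBl is_normZ// [leRHS]mulrAC ler_wpM2r ?is_norm_ge0//.
rewrite real_normK ?num_real// ler_norml.
move: yx; rewrite ler_norml /ramp => /andP[yx1 yx2].
have [x0|x0] := leP x 0; have [y0|y0] := leP y 0; rewrite ?(ler0_norm x0) ?(gtr0_norm x0).
- have : 0 <= (3 * - x + 1) * (y - x) ^+ 2 by rewrite mulr_ge0 ?sqr_ge0//; lra.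
  by move=> ?; apply/andP; split; lra.
- by apply/andP; split; nra.
- by apply/andP; split; nra.
- have -> : y ^+ 3 / 6 - x ^+ 3 / 6 - (y - x) * (x ^+ 2 / 2) =
    (y - x) ^+ 2 * ((y + 2 * x) / 6) by field.
  have h := sqr_ge0 (y - x); rewrite -mulNr [- _ * _]mulrC [_ * (_ ^+ 2)]mulrC.
  by apply/andP; split; rewrite ler_wpM2l//; lra.
Qed.

Lemma ramp_square_deriv (A : set R) (x : R) (v : 'rV[R]_d) :
  deriv_at A (fun y => (ramp y ^+ 2 / 2) *: v) x (ramp x *: v).
Proof.
apply: (deriv_at_quadratic N_norm (C := N v)) => y _ yx.
rewrite scalerA -2![_ *: v - _ *: v]scalerBl is_normZ// [leLHS]mulrC ler_wpM2l ?is_norm_ge0//.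
rewrite real_normK ?num_real// ler_norml /ramp.
have sq := sqr_ge0 (y - x); have sqx := sqr_ge0 x; have sqy := sqr_ge0 y.
by have [x0|x0] := leP x 0; have [y0|y0] := leP y 0; apply/andP; split; nra.
Qed.

Lemma ramp_continuous : continuous ramp.
Proof.
move=> x; apply/(@cvgrPdist_lt _ _ _ (nbhs x)) => e e0; near=> y.
have : `|x - y| < e by near: y; exact: cvgr_dist_lt.
rewrite !ltr_norml /ramp.
by have [x0|x0] := leP x 0; have [y0|y0] := leP y 0; lra.
Unshelve. all: by end_near. Qed.

End Ramp.

Section Histories.
Context {R : realType} {d : nat} (r : \bar R) (N : 'rV[R]_d -> R).
Hypotheses (N_norm : is_norm N) (r_ge0 : (0 <= r)%E).
Local Notation D := (delay_itv r).
Local Notation C1 := (C1_space r N).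

(** The criterion used to exhibit elements of [C1_space]: for an infinite delay
    the boundedness on the whole past must be checked, for a finite one it holds
    by compactness. *)
Lemma C1_hist (f df : R -> 'rV[R]_d) (t : R) :
  (forall x, deriv_at setT f x (df x)) -> continuous df ->
  (exists B : R, forall x, x <= t -> N (f x) <= B) ->
  (exists B : R, forall x, x <= t -> N (df x) <= B) -> C1 (hist r f t).
Proof.
move=> fd cdf [B fB] [B' dfB].
have past th : D th -> t + th <= t by case=> _ th0; lra.
split=> [th Dth|]; first by rewrite /hist /patch memNset.
exists (fun th => df (t + th)); split.
- move=> th Dth; apply: (@eq_deriv_at _ _ N N_norm D (fun y => f (t + y))) => //.
    by move=> y Dy; rewrite hist_in.
  apply/(deriv_atP N_norm) => e /(proj1 (deriv_atP N_norm _ _ _ _) (fd (t + th)))[dl dl0 near_th].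
  have shift y : t + y - (t + th) = y - th by rewrite opprD addrACA subrr add0r.
  by exists dl => // y _; have := near_th (t + y) I; rewrite shift.
- apply: continuous_subspaceT => th; apply: (continuous_comp (f := fun y => t + y)).
    by apply: cvgD; [exact: cvg_cst | exact: cvg_id].
  exact: cdf.
- by exists B => th Dth; rewrite hist_in//; apply: fB; exact: past.
- by exists B' => th Dth; apply: dfB; exact: past.
Qed.

Lemma C1_sum (I : finType) (P : pred I) (F : I -> R -> 'rV[R]_d) :
  (forall i, P i -> C1 (F i)) -> C1 (\sum_(i | P i) F i).
Proof.
move=> C1F; elim/big_ind: _ => //; first exact: C1_zero.
by move=> f g C1f C1g; rewrite -[f]scale1r; exact: C1_lin.
Qed.

Lemma C1_smooth_poly (p : {poly R}) (v : 'rV[R]_d) (h eps t : R) : 0 < h -> 0 < eps ->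
  C1 (hist r (fun x => p.[smooth_ramp eps x / h] *: v) t).
Proof.
move=> h0 eps0; pose psi x := smooth_ramp eps x / h.
pose c := (ramp t + eps) / h.
have psic x : x <= t -> 0 <= psi x <= c.
  move=> xt; have /andP[] := smooth_ramp_close x eps0.
  have : Num.max x 0 <= Num.max t 0 by rewrite ge_max !le_max xt lexx orbT.
  have : 0 <= Num.max x 0 by rewrite le_max lexx orbT.
  rewrite /psi /c /ramp => x0 xt' lo hi.
  by rewrite divr_ge0 ?(ltW h0)//= ?ler_pM2r ?invr_gt0//; lra.
have dpsi (x : R) : is_derive x (1 : R) psi (smooth_ramp_deriv eps x / h).
  have := smooth_ramp_is_derive x eps0 => dr.
  have -> : psi = h^-1 *: (smooth_ramp eps : R -> R) by apply/funext => y; rewrite /psi mulrC.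
  by apply: is_derive_eq; rewrite -[_ *: _]/(_ * _) mulrC.
have cpsi : continuous psi.
  by move=> x; apply: differentiable_continuous; apply/derivable1_diffP; case: (dpsi x).
apply: (@C1_hist _ (fun x => (p^`().[psi x] * (smooth_ramp_deriv eps x / h)) *: v)).
- by move=> x; apply: (deriv_at_scalar N_norm).
- apply: scalar_continuous => x; apply: cvgM.
    by apply: (continuous_comp (f := psi)); [exact: cpsi | exact: continuous_horner].
  by apply: cvgMl; exact: smooth_ramp_deriv_continuous.
- exists (poly_bound p c * N v) => x xt; rewrite is_normZ// ler_wpM2r ?is_norm_ge0//.
  by apply: poly_boundP; exact: psic.
- exists (poly_bound p^`() c * (1 / h) * N v) => x xt.
  rewrite is_normZ// ler_wpM2r ?is_norm_ge0// normrM ler_pM//.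
    by apply: poly_boundP; exact: psic.
  rewrite normrM normfV (gtr0_norm h0) ler_pM2r ?invr_gt0//.
  exact: smooth_ramp_deriv_le1.
Qed.

(** A stage function that starts from the zero history is a polynomial of the
    ramp, with a kink at [0]. Replacing the ramp by [smooth_ramp] removes the
    kink at an arbitrarily small cost. This density makes the stage values of
    the test problem below unique. *)
Lemma ramp_poly_approx (I : finType) (P : pred I) (p : I -> {poly R}) (v : I -> 'rV[R]_d)
    (h t dl : R) : 0 < h -> 0 < dl ->
  exists2 chi, C1 chi & forall th, D th ->
    N (chi th - \sum_(i | P i) (p i).[ramp (t + th) / h] *: v i) <= dl.
Proof.
move=> h0 dl0; pose c := (ramp t + 1) / h.
have /choice[L Lip] : forall i, exists L, 0 <= L /\
    forall x y, 0 <= x <= c -> 0 <= y <= c ->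
      N ((p i).[y] *: v i - (p i).[x] *: v i) <= L * `|y - x|.
  by move=> i; have [L] := poly_lipschitz N_norm (p i) c (v i); exists L.
pose q := \sum_(i | P i) L i.
have q0 : 0 <= q by apply: sumr_ge0 => i _; case: (Lip i).
have qh0 : 0 < q / h + 1 by rewrite ltr_wpDl// divr_ge0// ltW.
pose eps := Num.min 1 (dl / (q / h + 1)).
have eps0 : 0 < eps by rewrite lt_min ltr01 divr_gt0.
have eps1 : eps <= 1 by rewrite ge_min lexx.
have epsdl : eps * (q / h + 1) <= dl by rewrite -ler_pdivlMr// ge_min lexx orbT.
exists (\sum_(i | P i) hist r (fun x => (p i).[smooth_ramp eps x / h] *: v i) t).
  by apply: C1_sum => i _; exact: C1_smooth_poly.
move=> th Dth; rewrite fct_sumE -sumrB.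
apply: le_trans (is_norm_sum N_norm _ _) _; apply: le_trans epsdl.
apply: (@le_trans _ _ (\sum_(i | P i) L i * (eps / h))); last first.
  by rewrite -mulr_suml -/q mulrCA ler_wpM2l ?(ltW eps0)// lerDl.
apply: ler_sum => i _; rewrite hist_in//.
have th0 : th <= 0 by case: Dth.
have [L0 {}Lip] := Lip i.
set x := t + th; have /andP[lo hi] := smooth_ramp_close x eps0.
have rx : 0 <= ramp x <= ramp t.
  by rewrite /ramp le_max lexx orbT ge_max !le_max lexx orbT andbT /x; apply/orP; left; lra.
have hV : 0 < h^-1 by rewrite invr_gt0.
apply: le_trans (Lip _ _ _ _) _.
- by rewrite divr_ge0 ?(ltW h0)//= ?ler_pM2r//; lra.
- rewrite divr_ge0 ?(ltW h0)//= ?ler_pM2r//; rewrite -/(ramp x) in lo hi; lra.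
rewrite ler_wpM2l// -mulrBl normrM (gtr0_norm hV) ler_wpM2r ?(ltW hV)//.
by rewrite ger0_norm; rewrite -/(ramp x) in lo hi *; lra.
Qed.

End Histories.

(** * The order conditions are necessary *)

Section TimeOnlyProblem.
Context {R : realType} {d : nat} (r : \bar R) (N : 'rV[R]_d -> R).
Hypotheses (N_norm : is_norm N) (r_ge0 : (0 <= r)%E).
Variable v : 'rV[R]_d.
Local Notation D := (delay_itv r).
Local Notation C1 := (C1_space r N).
Local Notation nm := (max_norm r N).

(** The test problem [u'' = t *: v] started from the zero history at time 0.
    Its right-hand side does not look at the history, so the method reduces to
    a quadrature of a linear function, and its solution has a constant nonzero
    third derivative. *)
Definition linear_forcing (t : R) (phi : R -> 'rV[R]_d) : 'rV[R]_d := t *: v.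

Lemma linear_forcing_dom_open (t : R) phi : C1 phi -> exists2 e : R, 0 < e &
  forall s psi, `|s - t| < e -> C1 psi -> nm (psi - phi) < e -> C1 psi.
Proof. by exists 1. Qed.

Lemma linear_forcing_cont (t : R) phi : C1 phi -> forall e : R, 0 < e ->
  exists2 dl : R, 0 < dl & forall s psi, C1 psi -> `|s - t| < dl ->
    nm (psi - phi) < dl -> N (linear_forcing s psi - linear_forcing t phi) < e.
Proof.
move=> _ e e0; have Nv := is_norm_ge0 N_norm v; have Nv1 : 0 < N v + 1 by lra.
exists (e / (N v + 1)) => [|s psi _ st _]; first exact: divr_gt0.
rewrite -scalerBl is_normZ//; move: st; rewrite ltr_pdivlMr//.
by have := normr_ge0 (s - t); move: `|s - t| (N v) Nv => z n; nra.
Qed.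

Definition ramp_problem : problem r N :=
  @Problem R d r N [set tp | C1 tp.2] linear_forcing (fun _ _ => id)
    linear_forcing_dom_open linear_forcing_cont.

Definition ramp_solution (x : R) : 'rV[R]_d := (ramp x ^+ 3 / 6) *: v.

Lemma ramp_problem_C1 : rhs_class_C1 ramp_problem.
Proof.
have zero_le (e : R) phi : 0 <= e -> C1 phi -> N 0 <= e * nm phi.
  move=> e0 C1phi; rewrite is_norm0// mulr_ge0//.
  by apply: (max_norm_ge0 N_norm r_ge0); exact: C1_bounded.
exists (fun _ _ _ => 0); split.
- by move=> t phi _ k chi psi _ _; rewrite scaler0 addr0.
- move=> t phi _ e e0; exists 1 => // chi C1chi _ _.
  by rewrite subrr subr0; apply: zero_le => //; exact: ltW.
- by exists 0 => t phi chi _ C1chi; exact: zero_le.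
- move=> t phi _ e e0; exists 1 => // psi _ _ chi C1chi.
  by rewrite subrr; apply: zero_le => //; exact: ltW.
Qed.

Lemma ramp_le (x t : R) : x <= t -> 0 <= ramp x <= ramp t.
Proof.
move=> xt; rewrite /ramp le_max lexx orbT ge_max !le_max lexx xt orbT.
by [].
Qed.

Lemma ramp_solution_C1 (t : R) : C1 (hist r ramp_solution t).
Proof.
apply: (C1_hist r N_norm (df := fun x => (ramp x ^+ 2 / 2) *: v)).
- by move=> x; exact: (ramp_cube_deriv N_norm).
- apply: scalar_continuous => x; apply: cvgMl.
  apply: (continuous_comp (f := ramp) (g := fun y : R => y ^+ 2)); first exact: ramp_continuous.
  exact: exprn_continuous.
- exists (ramp t ^+ 3 / 6 * N v) => x /ramp_le/andP[x0 xt].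
  rewrite is_normZ// ler_wpM2r ?is_norm_ge0// ger0_norm ?divr_ge0 ?exprn_ge0//.
  by rewrite ler_pM2r ?invr_gt0// lerXn2r// ?nnegrE// (le_trans x0).
- exists (ramp t ^+ 2 / 2 * N v) => x /ramp_le/andP[x0 xt].
  rewrite is_normZ// ler_wpM2r ?is_norm_ge0// ger0_norm ?divr_ge0 ?exprn_ge0//.
  by rewrite ler_pM2r ?invr_gt0// lerXn2r// ?nnegrE// (le_trans x0).
Qed.

Lemma ramp_past (x : R) : x <= 0 -> ramp x = 0.
Proof. by move=> x0; rewrite /ramp max_r. Qed.

Lemma ramp_future (x : R) : 0 <= x -> ramp x = x.
Proof. by move=> x0; rewrite /ramp max_l. Qed.

Lemma ramp_history0 (x : R) : x <= 0 -> hist r ramp_solution 0 x = 0.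
Proof.
move=> x0; rewrite /hist /patch; case: ifP => // _.
by rewrite add0r /ramp_solution ramp_past// expr0n/= mul0r scale0r.
Qed.

Lemma ramp_solution_solves :
  solution ramp_problem 0 (hist r ramp_solution 0) 0 +oo%E ramp_solution
    (fun x => (ramp x ^+ 2 / 2) *: v).
Proof.
split => //.
- exact: (ramp_solution_C1 0).
- apply/(deriv_atP N_norm) => e e0; exists 1 => // y [_ y0] _.
  by rewrite !ramp_history0// scaler0 !subr0 is_norm0// mulr_ge0// ltW.
- exact: ltry.
- exists (fun x => ramp x *: v); split.
  + by move=> x _; exact: (ramp_cube_deriv N_norm).
  + by move=> x _; exact: (ramp_square_deriv N_norm).
  + by rewrite ramp_past// expr0n/= mul0r scale0r.
  + move=> t [t0 _]; split; first exact: (ramp_solution_C1 t).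
    by rewrite ramp_future.
Qed.

Lemma ramp_solution_noncontinuable v0 phi :
  noncontinuable ramp_problem 0 phi v0 +oo%E ramp_solution.
Proof. by move=> [tbar' [u' [du' [+ _ _]]]]; rewrite ltNge leey. Qed.

Lemma ramp_solution_class_C k (a b : R) : b <= 0 \/ 0 <= a ->
  class_C k `[a, b] ramp_solution.
Proof.
case=> [b0|a0].
  apply: (class_C_poly N_norm k (p := 0) (v := v)) => x; rewrite /= in_itv/= => /andP[_ xb].
  by rewrite horner0 /ramp_solution ramp_past ?expr0n/= ?mul0r//; exact: le_trans b0.
apply: (class_C_poly N_norm k (p := 6^-1 *: 'X^3) (v := v)) => x.
rewrite /= in_itv/= => /andP[ax _].
by rewrite hornerZ hornerXn mulrC /ramp_solution ramp_future//; exact: le_trans ax.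
Qed.

(** The solution is [0] before time 0 and a cubic after it, so it is piecewise
    smooth of every order: no smoothness level excludes it. *)
Lemma ramp_solution_piecewise_C k A : piecewise_C k A ramp_solution.
Proof.
move=> a b _ _ ab; have [->|a_neq_b] := eqVneq a b; first by exists [::].
have {ab a_neq_b} ab : a < b by rewrite lt_neqAle a_neq_b.
have [b0|b0] := leP b 0.
  by exists [:: b]; split; rewrite /= ?ab// => -[|//] _; apply: ramp_solution_class_C; left.
have [a0|a0] := leP 0 a.
  by exists [:: b]; split; rewrite /= ?ab// => -[|//] _; apply: ramp_solution_class_C; right.
exists [:: 0; b]; split; rewrite /= ?a0 ?b0// => -[|[|//]] _; apply: ramp_solution_class_C.
  by left.
by right.
Qed.

(** The defining limit of [rhs_value] pins the stage value down because the
    stage function can be approximated by histories, all of which have the same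
    image [(fc M i * h) *: v]. *)
Lemma ramp_stages s (M : fcrkn R s) (h : R) (K : 'I_s -> 'rV[R]_d) : 0 < h ->
  stages M ramp_problem 0 (hist r ramp_solution 0) 0 h K ->
  forall i, K i = (fc M i * h) *: v.
Proof.
move=> h0 K_stages i; have [_ limit] := K_stages i.
set Y := hist r (stage_fun _ _ _ _ _ _) _ in limit.
apply/eqP; rewrite eq_sym -subr_eq0; apply/eqP/(is_norm_eq0 N_norm)/eqP.
rewrite eq_le is_norm_ge0// andbT; apply/ler_addgt0Pr => e e0; rewrite add0r.
have [dl dl0 near_Y] := limit e e0.
have dl2 : 0 < dl / 2 by lra.
have [chi C1chi chiY] := ramp_poly_approx r N_norm (fun j : 'I_s => (j < i)%N)
  (fa M i) (fun j => h ^+ 2 *: K j) (fc M i * h) h0 dl2.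
have := near_Y chi C1chi; rewrite -[rhs _ _ _]/((0 + fc M i * h) *: v) add0r.
move=> H; apply: ltW; apply: H => //.
apply: (@le_lt_trans _ _ (dl / 2)); last by lra.
apply: (max_norm_le r_ge0) => th Dth; rewrite -[(_ - _) th]/(chi th - Y th).
suff -> : Y th = \sum_(j < s | (j < i)%N)
  (fa M i j).[ramp (fc M i * h + th) / h] *: (h ^+ 2 *: K j) by exact: chiY.
rewrite /Y hist_in// /stage_fun; set x := _ + th; case: leP => x0.
  rewrite ramp_history0//; apply/esym/big1 => j _.
  by rewrite ramp_past// mul0r fa0 scale0r.
rewrite ramp_history0// scaler0 !add0r scaler_sumr ramp_future ?(ltW x0)//.
by apply: eq_bigr => j _; rewrite !scalerA mulrC.
Qed.

(** The error of the derivative is exactly [h ^+ 2] times the defect of the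
    order condition times [v], and this can be [O(h ^+ 3)] only if the defect
    vanishes. *)
Lemma order_two_on_ramp s (M : fcrkn R s) (I : set R) (al : R) : v != 0 ->
  local_order M 2 I ramp_problem 0 (hist r ramp_solution 0) 0 ramp_solution
    (fun x => (ramp x ^+ 2 / 2) *: v) ->
  I al -> 0 <= al -> \sum_(i < s) (fdb M i).[al] * fc M i = al ^+ 2 / 2.
Proof.
move=> v0 [h0 [C [C' [h00 _ C'0 order]]]] Ial al0.
have Nv : 0 < N v.
  rewrite lt_neqAle is_norm_ge0// andbT eq_sym; apply: contra v0 => /eqP Nv0.
  by apply/eqP; exact: (is_norm_eq0 N_norm Nv0).
set sm := \sum_(i < s) _; apply/eqP; rewrite -subr_eq0 -normr_eq0.
set delta := (X in X == 0); have delta0 : 0 <= delta by exact: normr_ge0.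
have bound (h : R) : 0 < h < h0 -> delta * N v <= C' * h.
  move=> hh; have /andP[hpos _] := hh; have [K K_stages err] := order h hh.
  have KE := ramp_stages hpos K_stages.
  have [_] := err al Ial.
  rewrite /deta add0r add0r ramp_future; last by rewrite mulr_ge0// ltW.
  have -> : \sum_(i < s) (fdb M i).[al] *: K i = (h * sm) *: v.
    rewrite mulr_sumr scaler_suml; apply: eq_bigr => i _.
    by rewrite KE scalerA; congr (_ *: _); ring.
  rewrite scalerA -scalerBl is_normZ//.
  have -> : h * (h * sm) - (al * h) ^+ 2 / 2 = h ^+ 2 * (sm - al ^+ 2 / 2) by field.
  have h2 : 0 < h ^+ 2 by rewrite exprn_gt0.
  rewrite normrM (gtr0_norm h2) -/delta -mulrA.
  have -> : C' * h ^+ 3 = h ^+ 2 * (C' * h) by ring.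
  by rewrite ler_pM2l.
rewrite eq_le delta0 andbT; apply/ler_addgt0Pr => e e0; rewrite add0r.
pose h := Num.min (h0 / 2) (e * N v / C').
have hpos : 0 < h by rewrite lt_min divr_gt0//= divr_gt0// mulr_gt0.
have [hh0 he] : h < h0 /\ h <= e * N v / C'.
  split; last by rewrite ge_min lexx orbT.
  by apply: (@le_lt_trans _ _ (h0 / 2)); [rewrite ge_min lexx | lra].
have := bound h; rewrite hpos hh0 => /(_ isT) db.
rewrite -(ler_pM2r Nv); apply: le_trans db _.
by move: he; rewrite ler_pdivlMr// mulrC.
Qed.

End TimeOnlyProblem.

Lemma order_two_necessary (R : realType) (d s : nat) (r : \bar R) (N : 'rV[R]_d -> R)
    (M : fcrkn R s) (I : set R) (al : R)
    (S : problem r N -> R -> \bar R -> (R -> 'rV[R]_d) -> Prop) :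
  (0 < d)%N -> (0 <= r)%E -> is_norm N ->
  (forall pb sigma tbar u, rhs_class_C1 pb ->
     (forall k, piecewise_C k (solution_itv r sigma tbar) u) -> S pb sigma tbar u) ->
  has_order M S 2 I -> I al -> 0 <= al ->
  \sum_(i < s) (fdb M i).[al] * fc M i = al ^+ 2 / 2.
Proof.
move=> d0 r_ge0 N_norm smooth_S [k order] Ial al0.
pose v : 'rV[R]_d := const_mx 1.
have v0 : v != 0.
  apply/eqP => /rowP/(_ (Ordinal d0)); rewrite !mxE => /eqP.
  by rewrite oner_eq0.
have ramp_order : local_order M 2 I (ramp_problem r N_norm v) 0
    (hist r (ramp_solution v) 0) 0 (ramp_solution v) (fun x => (ramp x ^+ 2 / 2) *: v).
  apply: order; first exact: ramp_solution_solves.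
  - exact: ramp_solution_noncontinuable.
  - apply: smooth_S; first exact: (ramp_problem_C1 N_norm r_ge0).
    by move=> k'; exact: (ramp_solution_piecewise_C N_norm).
  - exact: (ramp_solution_piecewise_C N_norm).
exact: (order_two_on_ramp r_ge0 v0 ramp_order Ial al0).
Qed.

(** * The two equivalences *)

Theorem theorem1 (R : realType) (d s : nat) (r : \bar R) (N : 'rV[R]_d -> R)
    (M : fcrkn R s)
    (d_gt0 : (0 < d)%N) (r_ge0 : (0 <= r)%E) (N_norm : is_norm N)
    (sum_fdb : forall alpha : R, 0 <= alpha <= 1 ->
       \sum_(i < s) (fdb M i).[alpha] = alpha)
    (sum_fb : forall alpha : R, 0 <= alpha <= 1 ->
       \sum_(i < s) (fb M i).[alpha] = alpha ^+ 2 / 2)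
    (sum_fa : forall (i : 'I_s) (alpha : R), 0 <= alpha <= fc M i ->
       \sum_(j < s) (fa M i j).[alpha] = alpha ^+ 2 / 2) :
  let smooth (pb : problem r N) (sigma : R) (tbar : \bar R) (u : R -> 'rV[R]_d) :=
    rhs_class_C1 pb /\ piecewise_C 3 (solution_itv r sigma tbar) u in
  (uniform_order M smooth 2 <->
     (forall alpha : R, 0 <= alpha <= 1 ->
        \sum_(i < s) (fdb M i).[alpha] * fc M i = alpha ^+ 2 / 2)) /\
  (discrete_order M smooth 2 <->
     \sum_(i < s) (fdb M i).[1] * fc M i = 1 / 2).
Proof.
move=> smooth.
have smooth_C1 pb sigma tbar u : smooth pb sigma tbar u -> rhs_class_C1 pb by case.
have smooth_all pb sigma tbar u : rhs_class_C1 pb ->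
    (forall k, piecewise_C k (solution_itv r sigma tbar) u) ->
    smooth pb sigma tbar u by split.
split; split.
- move=> order al al01; have /andP[al0 _] := al01.
  by apply: (order_two_necessary d_gt0 r_ge0 N_norm smooth_all order); rewrite //= in_itv.
- move=> cond; apply: (order_two_sufficient N_norm r_ge0 smooth_C1) => al.
  by rewrite /= in_itv/= => al01; split=> //; [exact: sum_fdb | exact: sum_fb | exact: cond].
- move=> order.
  have := order_two_necessary d_gt0 r_ge0 N_norm smooth_all order (erefl 1) ler01.
  by rewrite expr1n.
- move=> cond; apply: (order_two_sufficient N_norm r_ge0 smooth_C1) => _ ->.
  by rewrite cond expr1n; split; rewrite ?ler01 ?lexx// ?sum_fdb ?sum_fb ?expr1n ?ler01 ?lexx.
Qed.
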